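(* Let $k$ be a field and let $\mathcal A$ be a finite set of hyperplanes through the origin in $\mathbb R^d$, with face semigroup $\mathcal F$, intersection lattice $\mathcal L$ and face semigroup algebra $k\mathcal F$. Let $X\in\mathcal L$. Then $$\cdots\longrightarrow\Big(\bigoplus_{Y\in\mathcal L,\ Y\le X,\ \operatorname{codim}_X(Y)=p}k\mathcal F_Y\Big)\xrightarrow{\ \partial\ }\cdots\xrightarrow{\ \partial\ }k\mathcal F_X\longrightarrow k_X\longrightarrow0$$ is a projective resolution of the simple $k\mathcal F$-module $k_X$ afforded by $\chi_X:k\mathcal F\to k$, where $\partial(w)=\sum_{y\gtrdot w}[w:y]\,\chi_X(y)\,y$ for faces $w$, the map $k\mathcal F_X\to k_X$ sends every face of support $X$ to $1$, and $\operatorname{codim}_X(Y)$ denotes the codimension of $Y$ in $X$.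
   Context: For each $H\in\mathcal A$ fix a labelling $H^+,H^-$ of the two open half-spaces determined by $H$, and put $H^0=H$. A face of $\mathcal A$ is a nonempty set of the form $x=\bigcap_{H\in\mathcal A}H^{\sigma_H}$ with $\sigma_H\in\{+,-,0\}$; write $\sigma_H(x)=\sigma_H$. $\mathcal F$ is the set of faces, partially ordered by $x\le y$ iff for each $H$ either $\sigma_H(x)=0$ or $\sigma_H(x)=\sigma_H(y)$; $y\gtrdot w$ means $y$ covers $w$ in this order (equivalently, $w$ is a codimension one face of $y$). The support of a face is $\operatorname{supp}(x)=\bigcap_{H:\sigma_H(x)=0}H$ (equal to $\mathbb R^d$ if no $\sigma_H(x)$ is $0$). The intersection lattice $\mathcal L=\operatorname{supp}(\mathcal F)$ is ordered by inclusion. The product $xy$ of faces is the face with $\sigma_H(xy)=\sigma_H(x)$ if $\sigma_H(x)\ne0$ and $\sigma_H(xy)=\sigma_H(y)$ if $\sigma_H(x)=0$. This makes $\mathcal F$ a semigroup with identity $1=\bigcap_{H\in\mathcal A}H$, and $k\mathcal F$ is its semigroup algebra over $k$. Modules are left modules. For $Y\in\mathcal L$, $\mathcal F_Y$ is the set of faces of support $Y$, and $k\mathcal F_Y$ is the $k$-vector space with basis $\mathcal F_Y$ with left $k\mathcal F$-module structure $w\cdot y=wy$ if $\operatorname{supp}(w)\le Y$ and $w\cdot y=0$ otherwise ($w\in\mathcal F$, $y\in\mathcal F_Y$). For $X\in\mathcal L$, $\chi_X:k\mathcal F\to k$ is the algebra homomorphism with $\chi_X(y)=1$ if $\operatorname{supp}(y)\le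 X$ and $\chi_X(y)=0$ otherwise ($y\in\mathcal F$); $k_X$ is the one-dimensional module on which $k\mathcal F$ acts through $\chi_X$. Incidence numbers: fix an orientation $\epsilon_X$ of every subspace $X\in\mathcal L$ ($\epsilon_X$ assigns to an ordered basis of $X$ the value $+1$ or $-1$ according to whether it is positively or negatively oriented). If $x$ is a codimension one face of $y$, pick a positively oriented basis $(e_1,\dots,e_i)$ of $\operatorname{supp}(x)$ and a vector $v\in y$, and put $[x:y]=\epsilon_{\operatorname{supp}(y)}(e_1,\dots,e_i,v)\in\{\pm1\}$ (this does not depend on the choices). *)

(* Defs.v *)
From HB Require Import structures.
From mathcomp Require Import all_boot all_order all_algebra finmap.
From mathcomp Require Import boolp classical_sets reals.
From mathcomp.multinomials Require Import monalg.

Set Implicit Arguments.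
Unset Strict Implicit.
Unset Printing Implicit Defensive.

Import Order.TTheory GRing.Theory Num.Theory.

Local Open Scope fset_scope.
Local Open Scope classical_set_scope.
Local Open Scope ring_scope.

Section Modules.
Variable S : pzRingType.

Definition projective_module (P : lmodType S) : Prop :=
  forall (M N : lmodType S) (g : {linear M -> N}) (h : {linear P -> N}),
    (forall n, exists m, g m = n) ->
    exists l : {linear P -> M}, forall x, g (l x) = h x.

Definition simple_module (M : lmodType S) : Prop :=
  (exists x : M, x != 0) /\
  forall N : {pred M}, submod_closed N -> N =i pred1 0 \/ N =i predT.

Definition projective_resolution (M : lmodType S) (P : nat -> lmodType S)
    (d : forall p, P p.+1 -> P p) (e : P 0%N -> M) : Prop :=
  [/\ forall p, projective_module (P p),
      (forall p, linear (d p)) /\ linear e,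
      range e = [set: M],
      range (d 0%N) = [set x | e x = 0] &
      forall p, range (d p.+1) = [set x | d p x = 0]].

End Modules.

Section DirectSum.
Variables (S : pzRingType) (I : finType) (M : I -> lmodType S).

(* For a finite index type the direct sum is the full dependent product. *)
Definition directsum := {dffun forall i : I, M i}.

HB.instance Definition _ := Choice.on directsum.

Implicit Types u v w : directsum.

Let zero : directsum := [ffun i => 0].
Let opp u : directsum := [ffun i => - u i].
Let add u v : directsum := [ffun i => u i + v i].
Let scale a u : directsum := [ffun i => a *: u i].

Fact directsum_addA : associative add.
Proof. by move=> u v w; apply/ffunP=> i; rewrite !ffunE addrA. Qed.
Fact directsum_addC : commutative add.
Proof. by move=> u v; apply/ffunP=> i; rewrite !ffunE addrC. Qed.
Fact directsum_add0 : left_id zero add.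
Proof. by move=> u; apply/ffunP=> i; rewrite !ffunE add0r. Qed.
Fact directsum_addN : left_inverse zero opp add.
Proof. by move=> u; apply/ffunP=> i; rewrite !ffunE addNr. Qed.

HB.instance Definition _ := GRing.isZmodule.Build directsum
  directsum_addA directsum_addC directsum_add0 directsum_addN.

Fact directsum_scaleA a b u : scale a (scale b u) = scale (a * b) u.
Proof. by apply/ffunP=> i; rewrite !ffunE scalerA. Qed.
Fact directsum_scale1 : left_id 1 scale.
Proof. by move=> u; apply/ffunP=> i; rewrite !ffunE scale1r. Qed.
Fact directsum_scaleDr : right_distributive scale +%R.
Proof. by move=> a u v; apply/ffunP=> i; rewrite !ffunE scalerDr. Qed.
Fact directsum_scaleDl u : {morph scale^~ u : a b / a + b}.
Proof. by move=> a b; apply/ffunP=> i; rewrite !ffunE scalerDl. Qed.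

HB.instance Definition _ := GRing.Zmodule_isLmodule.Build S directsum
  directsum_scaleA directsum_scale1 directsum_scaleDr directsum_scaleDl.

End DirectSum.

(* A finite set of linear hyperplanes of R^d with a labelling of their open
   half-spaces. The labelling is given by linear forms: H^+ and H^- are the
   loci where [form H] is positive and negative, and every labelling is of this
   shape. *)
Record arrangement (R : realType) (d : nat) := Arrangement {
  hyperplanes : {fset {vspace 'rV[R]_d}};
  form : hyperplanes -> 'Hom('rV[R]_d, R^o);
  hyperplane_dim : forall H : hyperplanes, (\dim (val H)).+1 = d;
  lker_form : forall H : hyperplanes, lker (form H) = val H
}.

Section Faces.
Variables (R : realType) (d : nat) (A : arrangement R d).
Local Notation V := 'rV[R]_d.

(* The signs +, -, 0 are [Some true], [Some false], [None]. *)
Definition side (H : hyperplanes A) (s : option bool) : set V :=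
  match s with
  | Some true => [set v | 0 < form H v]
  | Some false => [set v | form H v < 0]
  | None => [set v | v \in val H]
  end.

Definition cell (s : {ffun hyperplanes A -> option bool}) : set V :=
  \bigcap_H side H (s H).

(* Since the sides of H are disjoint, a face is determined by its signs, and we
   take a face to be a sign vector with a nonempty cell. *)
Record face := Face {
  sigma : {ffun hyperplanes A -> option bool};
  cell_neq0 : `[< cell sigma !=set0 >]
}.

HB.instance Definition _ := [isSub for sigma].
HB.instance Definition _ := [Finite of face by <:].

Implicit Types (x y z w : face) (H : hyperplanes A).

Lemma face_cellP x : exists v, cell (sigma x) v.
Proof. exact: asboolW (cell_neq0 x). Qed.

Lemma face_eqP x y : (forall H, sigma x H = sigma y H) -> x = y.
Proof. by move=> xy; apply/val_inj/ffunP. Qed.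

Definition face_le x y :=
  [forall H, (sigma x H == None) || (sigma x H == sigma y H)].

Fact face_le_refl : reflexive face_le.
Proof. by move=> x; apply/forallP=> H; rewrite eqxx orbT. Qed.
Fact face_le_anti : antisymmetric face_le.
Proof.
move=> x y /andP[/forallP xy /forallP yx]; apply: face_eqP => H.
move: (xy H) (yx H).
by case: (sigma x H) (sigma y H) => [[]|] [[]|].
Qed.
Fact face_le_trans : transitive face_le.
Proof.
move=> y x z /forallP xy /forallP yz; apply/forallP=> H.
move: (xy H) (yz H).
by case: (sigma x H) (sigma y H) (sigma z H) => [[]|] [[]|] [[]|].
Qed.

HB.instance Definition _ := Order.Le_isPOrder.Build (Order.Disp tt tt) face
  face_le_refl face_le_anti face_le_trans.

Definition covers y w := (w < y)%O && ~~ [exists z : face, (w < z < y)%O].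

Definition sign_mul (s t : {ffun hyperplanes A -> option bool}) :=
  [ffun H => if s H is Some b then Some b else t H].

Fact sign_one_cell : `[< cell [ffun=> None] !=set0 >].
Proof.
by apply/asboolP; exists 0 => H _; rewrite /side ffunE /= mem0v.
Qed.
Definition face_one := Face sign_one_cell.

(* If v lies in x and u in y, then v + t u lies in xy for all small t > 0. *)
Fact sign_mul_cell x y : `[< cell (sign_mul (sigma x) (sigma y)) !=set0 >].
Proof.
have [v xv] := face_cellP x; have [u yu] := face_cellP y.
pose b := \sum_(H : hyperplanes A) (`|form H u| / `|form H v|).
have b_ge0 : 0 <= b by apply: sumr_ge0 => H _; rewrite divr_ge0.
have b1 : 0 < b + 1 by rewrite ltr_wpDl.
have small (H : hyperplanes A) : form H v != 0 -> `|form H u| < (b + 1) * `|form H v|.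
  move=> fv; rewrite -ltr_pdivrMr ?normr_gt0 //.
  rewrite (le_lt_trans (y := b)) ?ltrDl //.
  by rewrite /b (bigD1 H) //= lerDl sumr_ge0 // => H' _; rewrite divr_ge0.
apply/asboolP; exists ((b + 1) *: v + u) => H _.
move: (xv H I) (yu H I); rewrite /side ffunE.
case sx : (sigma x H) => [[]|] /=.
- move=> v0 _; rewrite linearD linearZ /=.
  have := small H (lt0r_neq0 v0); rewrite (gtr0_norm v0).
  rewrite ltr_norml => /andP[+ _]; rewrite -subr_gt0 opprK addrC.
  by rewrite /GRing.scale /= addrC.
- move=> v0 _; rewrite linearD linearZ /=.
  have := small H (ltr0_neq0 v0); rewrite (ltr0_norm v0).
  rewrite ltr_norml => /andP[_ +]; rewrite -subr_lt0 mulrN opprK.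
  by rewrite /GRing.scale /= addrC.
- rewrite -lker_form memv_ker => /eqP v0.
  by case: (sigma y H) => [[]|] /=;
    rewrite ?memv_ker linearD linearZ /= v0 scaler0 add0r // memv_ker.
Qed.
Definition face_mul x y := Face (sign_mul_cell x y).

Fact face_mulA : associative face_mul.
Proof.
by move=> x y z; apply: face_eqP => H; rewrite !ffunE; case: (sigma x H).
Qed.
Fact face_mul1 : left_id face_one face_mul.
Proof. by move=> x; apply: face_eqP => H; rewrite !ffunE. Qed.
Fact face_mulr1 : right_id face_one face_mul.
Proof.
by move=> x; apply: face_eqP => H; rewrite !ffunE; case: (sigma x H).
Qed.
Fact face_unit x y : face_mul x y = face_one -> x = face_one /\ y = face_one.
Proof.
move=> /(congr1 sigma)/ffunP xy1.
by split; apply: face_eqP => H; move: (xy1 H); rewrite !ffunE;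
  case: (sigma x H).
Qed.

HB.instance Definition _ := Choice_isMonomialDef.Build face
  face_mulA face_mul1 face_mulr1 face_unit.

Definition supp_space x : {vspace V} :=
  (\bigcap_(H | sigma x H == None) val H)%VS.

Definition flats : {fset {vspace V}} := [fset supp_space x | x in predT].

Fact supp_subproof x : supp_space x \in flats.
Proof. exact: in_imfset. Qed.
Definition supp x : flats := [` supp_subproof x].

(* e takes the values 1 and -1 on the ordered bases of U, and two bases get the
   same value iff the change of basis has positive determinant. Both values are
   allowed on the empty basis of the zero space. *)
Definition orientation (U : {vspace V}) (e : seq V -> int) : Prop :=
  forall b c : (\dim U).-tuple V, basis_of U b -> basis_of U c ->
    (e b = 1 \/ e b = - 1) /\
    e c = sgz (\det (\matrix_(i, j) coord b j (tnth c i))) * e b.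

(* The default [::] only matters when x is the zero face and the empty basis of
   the zero space is negatively oriented: no positively oriented basis exists
   then, and the unique basis [::] is used. *)
Definition incidence (eps : flats -> seq V -> int) x y : int :=
  let b := xget [::] [set b | basis_of (val (supp x)) b /\ eps (supp x) b = 1] in
  let v := xget 0 (cell (sigma y)) in
  eps (supp y) (rcons b v).

Lemma mem_suppP x H : reflect (sigma x H = None) (val (supp x) <= val H)%VS.
Proof.
apply: (iffP idP) => [sH|sH]; last first.
  by apply: bigcapv_inf (subvv _); rewrite sH.
have [v xv] := face_cellP x.
have : v \in val H.
  apply: (subvP sH); rewrite memvE; apply/subv_bigcapP => H' /eqP sH'.
  by have := xv H' I; rewrite sH' /= memvE.
move: (xv H I); rewrite -lker_form memv_ker /side.
by case: (sigma x H) => [[]|] //= v0 /eqP fv; move: v0; rewrite fv ltxx.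
Qed.

Lemma supp_leP x y :
  reflect (forall H, sigma y H = None -> sigma x H = None)
          (val (supp x) <= val (supp y))%VS.
Proof.
apply: (iffP idP) => [xy H /mem_suppP yH|xy].
  by apply/mem_suppP/(subv_trans xy).
by apply/subv_bigcapP => H /eqP/xy xH; apply/mem_suppP.
Qed.

Lemma flatP (X : flats) : exists x, X = supp x.
Proof.
have /imfsetP[x /= _ Xx] := valP X.
by exists x; apply: val_inj.
Qed.

Lemma supp_mul_le x y (X : flats) :
  (val (supp (mmul x y)) <= val X)%VS
  = (val (supp x) <= val X)%VS && (val (supp y) <= val X)%VS.
Proof.
have [z ->] := flatP X; apply/supp_leP/andP => [xyz|[/supp_leP xz /supp_leP yz]].
  by split; apply/supp_leP => H /xyz; rewrite ffunE; case: (sigma x H).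
by move=> H zH; rewrite ffunE xz ?yz.
Qed.

Lemma supp_one_le (X : flats) : (val (supp (mone : face)) <= val X)%VS.
Proof. by have [z ->] := flatP X; apply/supp_leP => H _; rewrite ffunE. Qed.

Lemma supp_mul x y :
  (val (supp x) <= val (supp y))%VS -> supp (mmul x y) = supp y.
Proof.
move=> /supp_leP xy; apply: val_inj; apply: eq_bigl => H.
rewrite ffunE; move: (xy H).
by case: (sigma x H) (sigma y H) => [b|] [c|] // /(_ erefl).
Qed.

End Faces.

Section FaceAlgebra.
Variables (k : fieldType) (R : realType) (d : nat) (A : arrangement R d).
Local Notation V := 'rV[R]_d.
Local Notation F := (face A).
Local Notation L := (flats A).
Local Notation kF := {malg k[F]}.

Implicit Types (X Y : L) (a b : kF) (w x y : F).

Definition chi_mod X : Type := k.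
HB.instance Definition _ X := GRing.Zmodule.copy (chi_mod X) k.

Section Character.
Variable X : L.

Definition chi_face y : k := (val (supp y) <= val X)%VS%:R.

Fact chi_face_is_mmorphism : mmorphism chi_face.
Proof.
split=> [x y|]; last by rewrite /chi_face supp_one_le.
by rewrite /chi_face supp_mul_le -mulnb natrM.
Qed.
HB.instance Definition _ := isMultiplicative.Build F k chi_face
  chi_face_is_mmorphism.

Definition chi : kF -> k := mmap idfun chi_face.
HB.instance Definition _ := GRing.RMorphism.on chi.

Let scale a (c : chi_mod X) : chi_mod X := chi a * c.

Fact chi_mod_scaleA a b c : scale a (scale b c) = scale (a * b) c.
Proof. by rewrite /scale rmorphM mulrA. Qed.
Fact chi_mod_scale1 : left_id 1 scale.
Proof. by move=> c; rewrite /scale rmorph1 mul1r. Qed.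
Fact chi_mod_scaleDr : right_distributive scale +%R.
Proof. by move=> a b c; rewrite /scale mulrDr. Qed.
Fact chi_mod_scaleDl c : {morph scale^~ c : a b / a + b}.
Proof. by move=> a b; rewrite /scale rmorphD mulrDl. Qed.

HB.instance Definition _ := GRing.Zmodule_isLmodule.Build kF (chi_mod X)
  chi_mod_scaleA chi_mod_scale1 chi_mod_scaleDr chi_mod_scaleDl.
End Character.

Section FaceModule.
Variable Y : L.

Definition faces_of := {y : F | supp y == Y}.

Definition face_mod := {ffun faces_of -> k^o}.
HB.instance Definition _ := GRing.Zmodule.on face_mod.

(* The basis vector y of kF_Y if supp y = Y, and 0 otherwise. *)
Definition basis_vec y : face_mod := [ffun z => (val z == y)%:R].

Definition face_act w (y : faces_of) : face_mod :=
  if (val (supp w) <= val Y)%VS then basis_vec (mmul w (val y)) else 0.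

(* a v = \sum_(w, y) a_w v_y (w . y) for a = \sum_w a_w w, v = \sum_y v_y y *)
Definition face_mod_scale a (v : face_mod) : face_mod :=
  [ffun z => \sum_(w : F) \sum_(y : faces_of) a@_w * v y * face_act w y z].

Fact face_act_comp w x (y z : faces_of) :
  \sum_(y' : faces_of) face_act x y y' * face_act w y' z
  = face_act (mmul w x) y z.
Proof.
rewrite /face_act supp_mul_le.
have [xY|xY] := boolP (val (supp x) <= val Y)%VS; last first.
  by rewrite andbF ffunE big1 // => y' _; rewrite ffunE mul0r.
have xyY : supp (mmul x (val y)) == Y.
  by rewrite supp_mul (eqP (valP y)).
rewrite andbT (bigD1 (exist _ (mmul x (val y)) xyY : faces_of)) //= big1 ?addr0 => [|y' y'E].
  by rewrite ffunE eqxx mul1r; case: ifP => // _; rewrite !ffunE mulmA.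
rewrite ffunE; case: eqP => [y'xy|_]; last by rewrite mul0r.
by case/negP: y'E; apply/eqP/val_inj.
Qed.

Fact mcoeffM_sum a b x :
  (a * b)@_x = \sum_(w : F) \sum_(w' : F) a@_w * b@_w' *+ (mmul w w' == x).
Proof.
pose T : {fset F} := [fset y | y in predT].
have sT (g : kF) : (msupp g `<=` T)%fset.
  by apply/fsubsetP => y _; apply/imfsetP; exists y.
have sumT (f : F -> k) : \sum_(y <- T) f y = \sum_(y : F) f y.
  by rewrite big_imfset //= big_enum.
rewrite (mcoeffMlw x (sT a) (sT b)) sumT.
by apply: eq_bigr => w _; rewrite sumT.
Qed.

Fact face_mod_scaleA a b v :
  face_mod_scale a (face_mod_scale b v) = face_mod_scale (a * b) v.
Proof.
apply/ffunP => z; rewrite !ffunE.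
transitivity (\sum_(w : F) \sum_(x : F) \sum_(y : faces_of)
    a@_w * b@_x * v y * face_act (mmul w x) y z).
  apply: eq_bigr => w _.
  under eq_bigr => y' _.
    rewrite ffunE mulr_sumr mulr_suml.
    under eq_bigr => x _.
      rewrite mulr_sumr mulr_suml.
      under eq_bigr => y _ do
        rewrite [X in X * _](_ : _ = a@_w * b@_x * v y * face_act x y y')
                ?mulrA // -mulrA.
      over.
    over.
  rewrite exchange_big /=; apply: eq_bigr => x _.
  rewrite exchange_big /=; apply: eq_bigr => y _.
  by rewrite -mulr_sumr face_act_comp.
under [RHS]eq_bigr => u _.
  under eq_bigr => y _.
    rewrite mcoeffM_sum -mulrA mulr_suml.
    under eq_bigr => w _ do rewrite mulr_suml.
    over.
  rewrite exchange_big /=.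
  under eq_bigr => w _ do rewrite exchange_big /=.
  over.
rewrite [RHS]exchange_big /=; apply: eq_bigr => w _.
rewrite [RHS]exchange_big /=; apply: eq_bigr => x _.
rewrite [RHS]exchange_big /=; apply: eq_bigr => y _.
rewrite (bigD1 (mmul w x)) //= eqxx mulr1n big1 ?addr0 ?mulrA // => u.
by rewrite eq_sym => /negPf->; rewrite mulr0n mul0r.
Qed.

Fact face_mod_scale1 : left_id 1 face_mod_scale.
Proof.
move=> v; apply/ffunP => z; rewrite !ffunE (bigD1 (mone : F)) //=.
rewrite [X in _ + X]big1 ?addr0 => [|w w1]; last first.
  by apply: big1 => y _; rewrite mcoeff1 (negPf w1) !mul0r.
rewrite (bigD1 z) //= big1 ?addr0 => [|y yz]; rewrite mcoeff1 eqxx mul1r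
  /face_act supp_one_le ffunE mul1m.
  by rewrite eqxx mulr1.
by rewrite (inj_eq val_inj) eq_sym (negPf yz) mulr0.
Qed.

Fact face_mod_scaleDr : right_distributive face_mod_scale +%R.
Proof.
move=> a u v; apply/ffunP => z; rewrite !ffunE -big_split /=.
apply: eq_bigr => w _; rewrite -big_split /=.
by apply: eq_bigr => y _; rewrite ffunE mulrDr mulrDl.
Qed.

Fact face_mod_scaleDl v : {morph face_mod_scale^~ v : a b / a + b}.
Proof.
move=> a b; apply/ffunP => z; rewrite !ffunE -big_split /=.
apply: eq_bigr => w _; rewrite -big_split /=.
by apply: eq_bigr => y _; rewrite mcoeffD !mulrDl.
Qed.

HB.instance Definition _ := GRing.Zmodule_isLmodule.Build kF face_mod
  face_mod_scaleA face_mod_scale1 face_mod_scaleDr face_mod_scaleDl.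
End FaceModule.

Section Resolution.
Variables (X : L) (eps : L -> seq V -> int).

Definition flats_codim (p : nat) :=
  {Y : L | (val Y <= val X)%VS && (\dim (val X) - \dim (val Y) == p)%N}.

Definition chain (p : nat) : lmodType kF :=
  directsum (fun Y : flats_codim p => face_mod (val Y)).

(* The basis vector y of the degree p term, lying in the summand of supp y; it
   is 0 if supp y is not among the flats of that degree. *)
Definition chain_vec p y : chain p := [ffun Y => basis_vec (val Y) y].

(* Scalars c of k act on kF-modules as c%:MP, the multiple c 1 of the identity
   face. The faces y covering a face w of codimension p + 1 in X with
   chi X y <> 0 are of codimension p in X, so chain_vec drops no term. *)
Definition boundary_face p w : chain p :=
  \sum_(y : F | covers y w)
    ((incidence eps w y)%:~R * chi X << y >>)%:MP *: chain_vec p y.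

Definition boundary p (c : chain p.+1) : chain p :=
  \sum_(Y : flats_codim p.+1) \sum_(w : faces_of (val Y))
    (c Y w)%:MP *: boundary_face p (val w).

(* X is the only flat of codimension 0 in X: the degree 0 term is kF_X. *)
Lemma flats_codim0 (Y : flats_codim 0) : val Y = X.
Proof.
apply/val_inj/eqP; have /andP[YX] := valP Y.
by rewrite eqEdim YX subn_eq0.
Qed.

Definition augmentation (c : chain 0) : chi_mod X :=
  \sum_(Y : flats_codim 0) \sum_(y : faces_of (val Y)) c Y y.

End Resolution.
End FaceAlgebra.

Arguments boundary k {R d A} X eps p c.
Arguments augmentation k {R d A} X c.

(* Main.v *)
Require Import Defs.
From HB Require Import structures.
From mathcomp Require Import all_boot all_order all_algebra finmap.
From mathcomp Require Import boolp classical_sets reals.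
From mathcomp.multinomials Require Import monalg.
From mathcomp Require Import perm lra.

Set Implicit Arguments.
Unset Strict Implicit.
Unset Printing Implicit Defensive.

Import Order.TTheory GRing.Theory Num.Theory.
Local Open Scope classical_set_scope.
Local Open Scope ring_scope.
Local Notation form := Defs.form.

(** The complex is the cellular chain complex of the zonotope dual to the
arrangement cut out on X, and its augmentation is exact because a convex body
is contractible. The proof below replaces this topology by an induction on
convex regions.

Incidence numbers enter through two facts only. If w is a wall of y, then
[w : y] depends on the supports of w and y and on the side of w on which y lies
(incidence_side), so the two faces with given support around a wall have
opposite incidence numbers. If y and y' are the two faces strictly between x
and z, with dim z = dim x + 2, then [x : y][y : z] = - [x : y'][y' : z]
(incidence_diamond); both products compare an orientation of supp z with one
basis of supp x completed by points of y and y', taken in the two orders.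

Exactness. A chain is a function on faces. For a flat X and prescribed signs at
some hyperplanes consider the faces of support at most X having these signs:
they fill an open convex cone of X. Every cycle of augmentation 0 supported on
such a region is the boundary of a chain supported there (region_exact). If a
hyperplane H meets the region without containing X, it cuts it into two open
halves and a section in X and H. The part of the cycle on the section is a cycle
of augmentation 0 there, hence a boundary by induction; subtracting it, and
then a multiple of the boundary of one top dimensional face of the section,
leaves two cycles of augmentation 0, one on each half, to which the induction
applies. If every hyperplane that meets the region contains X, then the region
has at most one face, of support X.

Projectivity. Let e be the product, in any order, of the elements 1 - v over
the faces v with support not below Y. Faces satisfy u v u = u v, hence
u a u = u a for every a in the algebra, so u e = 0 whenever supp u is not below
Y: the factor 1 - u of e kills u times the factors before it. On the other hand
e acts as the identity on kF_Y. Given a surjection g : M -> N and h : kF_Y -> N,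
choose m in M over the image of one basis face; then y |-> y e m is a lift of h
(face_mod_projective).

Linearity of the boundary. If supp w is below supp y, then z |-> w z is an
incidence preserving bijection from the faces having y as a wall onto those
having w y as a wall. Otherwise w z does not depend on the side of y on which z
lies, and the terms of w times the boundary of y cancel in pairs. *)

(** * Orientations and changes of basis *)

Section Orientation.
Variables (R : realType) (d : nat).
Local Notation V := 'rV[R]_d.
Implicit Types (U W : {vspace V}) (e : seq V -> int).

Lemma size_basis_seq U (b : seq V) : basis_of U b -> size b = \dim U.
Proof. by move=> Ub; rewrite -(span_basis Ub); have /eqP := basis_free Ub. Qed.

Lemma orientation_sqr U e (b : seq V) :
  orientation U e -> basis_of U b -> e b * e b = 1.
Proof.
move=> oe Ub; have sb : size b == \dim U by rewrite (size_basis_seq Ub).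
by have [[->|->] _] := oe (Tuple sb) (Tuple sb) Ub Ub.
Qed.

(** The matrix M is the coordinate matrix of c in b, by uniqueness of coordinates;
it is an argument here so that its determinant can be computed from its shape. *)
Lemma orientation_change U e n (b c : n.-tuple V) (M : 'M[R]_n) :
    orientation U e -> basis_of U b -> \det M != 0 ->
    (forall i : 'I_n, c`_i = \sum_j M i j *: b`_j) ->
  basis_of U c /\ e c = sgz (\det M) * e b.
Proof.
move=> oe Ub detM cE.
have dimU : \dim U = n by rewrite -(size_basis_seq Ub) size_tuple.
have uM : M \in unitmx by rewrite unitmxE unitfE.
have bE (j : 'I_n) : b`_j = \sum_i invmx M j i *: c`_i.
  under eq_bigr => i _ do rewrite cE scaler_sumr.
  rewrite exchange_big /=.
  transitivity (\sum_l (invmx M *m M) j l *: b`_l).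
    rewrite mulVmx // (bigD1 j) //= !mxE eqxx scale1r big1 ?addr0 // => l lj.
    by rewrite mxE eq_sym (negPf lj) scale0r.
  apply: eq_bigr => l _; rewrite mxE scaler_suml.
  by apply: eq_bigr => i _; rewrite scalerA.
have Uc : basis_of U c.
  rewrite basisEdim size_tuple dimU leqnn andbT -(span_basis Ub).
  apply/span_subvP => v /(nthP 0)[j]; rewrite size_tuple => jn <-.
  rewrite (bE (Ordinal jn)); apply: memv_suml => i _; apply/memvZ/memv_span.
  by rewrite mem_nth ?size_tuple.
split=> //; rewrite /orientation in oe.
case: n / dimU b c M Ub Uc cE oe {detM uM bE} => b c M Ub Uc cE oe.
have [_ ->] := oe b c Ub Uc; congr (sgz (\det _) * _).
apply/matrixP=> i j; rewrite !mxE (tnth_nth 0) cE.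
exact/coord_sum_free/(basis_free Ub).
Qed.

Lemma basis_rcons U W (b : seq V) v :
    (U <= W)%VS -> \dim W = (\dim U).+1 -> basis_of U b -> v \in W ->
  v \notin U -> basis_of W (rcons b v).
Proof.
move=> UW dimW Ub Wv Uv.
have bv : perm_eq (rcons b v) (v :: b) by rewrite perm_rcons.
rewrite basisEfree (perm_free bv) free_cons (span_basis Ub) Uv (basis_free Ub).
rewrite size_rcons (size_basis_seq Ub) dimW leqnn !andbT.
apply/span_subvP => u; rewrite mem_rcons inE => /predU1P[->//|bu].
exact/(subvP UW)/(basis_mem Ub).
Qed.

(** The transition matrix is block triangular with diagonal blocks N and a. *)
Lemma orientation_rcons W e n (b b' : n.-tuple V) (N : 'M[R]_n) (r : 'rV[R]_n)
    (a : R) (v v' : V) :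
    orientation W e -> basis_of W (rcons b v) -> \det N != 0 -> a != 0 ->
    (forall i : 'I_n, b'`_i = \sum_j N i j *: b`_j) ->
    v' = \sum_j r 0 j *: b`_j + a *: v ->
  e (rcons b' v') = sgz (\det N) * sgz a * e (rcons b v).
Proof.
move=> oe Wb detN a0 b'E v'E.
pose M : 'M[R]_(n + 1) := block_mx N 0 r a%:M.
have dM : \det M = \det N * a by rewrite det_lblock det_scalar1.
have cE (u : V) (w : n.-tuple V) : rcons w u = cat_tuple w [tuple u].
  by rewrite /= cats1.
rewrite (cE v) (cE v') -sgzM -dM in Wb *.
have [] // := orientation_change oe Wb (_ : \det M != 0) (c := cat_tuple b' [tuple v']).
  by rewrite dM mulf_neq0.
move=> i; rewrite big_split_ord /=.
have nth1 (w : n.-tuple V) u (j : 'I_n) : (w ++ [:: u])`_j = w`_j.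
  by rewrite nth_cat size_tuple ltn_ord.
have nth2 (w : n.-tuple V) u (j : 'I_1) : (w ++ [:: u])`_(n + j) = u.
  by rewrite nth_cat size_tuple ltnNge leq_addr addKn (ord1 j).
case: (split_ordP i) => [j|j] -> /=.
  rewrite nth1 b'E big_ord1 block_mxEur mxE scale0r addr0.
  by apply: eq_bigr => l _; rewrite block_mxEul nth1.
rewrite nth2 v'E big_ord1 (ord1 j) block_mxEdr nth2 mxE eqxx mulr1n; congr (_ + _).
by apply: eq_bigr => l _; rewrite block_mxEdl nth1.
Qed.

(** The case where N is the identity: only the component of v' along v matters,
so the orientation tells on which side of U in W a vector lies. *)
Lemma orientation_last U W e (b : seq V) (u v v' : V) (a : R) :
    orientation W e -> (U <= W)%VS -> \dim W = (\dim U).+1 -> basis_of U b ->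
    v \in W -> v \notin U -> u \in U -> a != 0 -> v' = u + a *: v ->
  e (rcons b v') = sgz a * e (rcons b v).
Proof.
move=> oe UW dimW Ub Wv Uv Uu a0 v'E.
have sb : size b == \dim U by rewrite (size_basis_seq Ub).
rewrite -[b]/(tval (Tuple sb)).
rewrite (@orientation_rcons W e _ (Tuple sb) (Tuple sb) 1%:M
  (\row_j coord (Tuple sb) j u) a v v') ?det1 ?oner_neq0 ?sgz1 ?mul1r //.
- exact: (basis_rcons UW dimW Ub).
- move=> i; rewrite (bigD1 i) //= mxE eqxx scale1r big1 ?addr0 // => j ji.
  by rewrite mxE eq_sym (negPf ji) scale0r.
- rewrite v'E; congr (_ + _); rewrite {1}(coord_basis (X := Tuple sb) Ub Uu).
  by apply: eq_bigr => j _; rewrite mxE.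
Qed.

(** Both factors change by the sign of the same determinant when b is replaced by
b'. Hence an incidence number may be computed from any basis of the wall. *)
Lemma orientation_init U W e e' (b b' : seq V) (v : V) :
    orientation U e' -> orientation W e ->
    (U <= W)%VS -> \dim W = (\dim U).+1 -> basis_of U b -> basis_of U b' ->
    v \in W -> v \notin U ->
  e' b' * e (rcons b' v) = e' b * e (rcons b v).
Proof.
move=> oe' oe UW dimW Ub Ub' Wv Uv.
have sb : size b == \dim U by rewrite (size_basis_seq Ub).
have sb' : size b' == \dim U by rewrite (size_basis_seq Ub').
pose c := Tuple sb; pose c' := Tuple sb'.
pose N := \matrix_(i, j) coord c j (tnth c' i).
have [_ e'b'] : _ /\ e' b' = sgz (\det N) * e' b := oe' c c' Ub Ub'.
have N0 : \det N != 0.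
  apply/eqP => N0; move: (orientation_sqr oe' Ub').
  by rewrite e'b' N0 sgz0 !mul0r.
rewrite (_ : e (rcons b' v) = sgz (\det N) * e (rcons b v)).
  by rewrite e'b' mulrACA mulz_sg N0 mul1r.
rewrite (@orientation_rcons W e _ c c' N 0 1 v v) ?sgz1 ?mulr1 ?oner_neq0 //.
- exact: (basis_rcons UW dimW Ub).
- move=> i; rewrite {1}(coord_basis (X := c) Ub (_ : c'`_i \in U)).
    by apply: eq_bigr => j _; rewrite mxE (tnth_nth 0).
  by rewrite (basis_mem Ub') // mem_nth // (eqP sb').
- by rewrite big1 ?add0r ?scale1r // => j _; rewrite mxE scale0r.
Qed.

(** The transition matrix is the permutation matrix of a transposition. *)
Lemma orientation_swap W e (b : seq V) (u v : V) :
    orientation W e -> basis_of W (rcons (rcons b u) v) ->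
  e (rcons (rcons b v) u) = - e (rcons (rcons b u) v).
Proof.
move=> oe Wb; set n := size b.
have su (x y : V) : size (rcons (rcons b x) y) == n.+2 by rewrite !size_rcons.
pose s : 'S_n.+2 := tperm (inord n) (inord n.+1).
have ds : \det (perm_mx s : 'M[R]_n.+2) = -1.
  by rewrite det_perm odd_tperm -val_eqE /= !inordK // neq_ltn ltnSn expr1.
have [] // := @orientation_change W e _ (Tuple (su u v)) (Tuple (su v u))
  (perm_mx s) oe Wb _ _.
- by rewrite ds oppr_eq0 oner_neq0.
- move=> i; rewrite (bigD1 (s i)) //= !mxE eqxx scale1r big1 ?addr0; last first.
    by move=> j ji; rewrite !mxE eq_sym (negPf ji) scale0r.
  have nE (x y : V) : (rcons (rcons b x) y)`_n = x.
    by rewrite !nth_rcons size_rcons -/n ltnSn ltnn eqxx.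
  have n1E (x y : V) : (rcons (rcons b x) y)`_n.+1 = y.
    by rewrite nth_rcons size_rcons -/n ltnn eqxx.
  rewrite /= /s; case: tpermP => [->|->|]; rewrite ?inordK ?nE ?n1E //.
  move=> /eqP; rewrite -val_eqE /= inordK // => i1.
  move=> /eqP; rewrite -val_eqE /= inordK // => i2.
  have lti : (i < n)%N.
    by have := ltn_ord i; rewrite ltnS leq_eqVlt (negPf i2) ltnS leq_eqVlt (negPf i1).
  by rewrite !nth_rcons !size_rcons -/n lti ltnS ltnW.
- by move=> _ /= ->; rewrite ds sgzN sgz1 mulN1r.
Qed.
End Orientation.

(** * Points, signs and supports of faces *)

Section Geometry.
Variables (R : realType) (d : nat) (A : arrangement R d).
Local Notation V := 'rV[R]_d.
Implicit Types (x y z w : face A) (H : hyperplanes A) (X Y : flats A) (v : V).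

(** The sides +, -, 0 of a real number, in the encoding of sign vectors. *)
Definition sgn (a : R) : option bool :=
  if 0 < a then Some true else if a < 0 then Some false else None.

Lemma sgn0 a : (sgn a = None) <-> (a = 0).
Proof.
rewrite /sgn; case: ltrgt0P => a0; split=> //; move: a0 => /[swap] ->;
  by rewrite ltxx.
Qed.

Lemma sgn_pos a : (sgn a = Some true) <-> (0 < a).
Proof. by rewrite /sgn; case: ltrgt0P. Qed.

Lemma sgn_neg a : (sgn a = Some false) <-> (a < 0).
Proof. by rewrite /sgn; case: ltrgt0P => // ->; rewrite ltxx. Qed.

Lemma sgnN a : sgn (- a) = omap negb (sgn a).
Proof. by rewrite /sgn oppr_gt0 oppr_lt0; case: ltrgt0P. Qed.

Lemma sgn_eqM a b : a != 0 -> b != 0 ->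
  sgz (a / b) = if sgn a == sgn b then 1 else -1.
Proof.
have sgzV : sgz b^-1 = sgz b.
  case: (ltrgt0P b) => [b0|b0|->]; last by rewrite invr0.
    by rewrite !gtr0_sgz ?invr_gt0.
  by rewrite !ltr0_sgz ?invr_lt0.
rewrite sgzM sgzV /sgn.
by case: (ltrgt0P a) => [a0|a0|->]; case: (ltrgt0P b) => [b0|b0|->];
   rewrite ?eqxx // ?(gtr0_sgz a0) ?(ltr0_sgz a0) ?(gtr0_sgz b0) ?(ltr0_sgz b0).
Qed.

Lemma mem_hyperplane H v : (v \in val H) = (form H v == 0).
Proof. by rewrite -lker_form memv_ker. Qed.

Lemma sideP H s v : side H s v <-> s = sgn (form H v).
Proof.
case: s => [[]|] /=.
- by split=> [/sgn_pos|/esym/sgn_pos].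
- by split=> [/sgn_neg|/esym/sgn_neg].
- rewrite mem_hyperplane; split=> [/eqP/sgn0 //|/esym/sgn0 ->]; exact: eqxx.
Qed.

(** This is the point from which incidence numbers are computed. *)
Definition point x : V := xget 0 (cell (sigma x)).

Lemma cell_point x : cell (sigma x) (point x).
Proof. by have [v xv] := face_cellP x; apply: (xgetPex 0 (ex_intro _ v xv)). Qed.

Lemma sigma_point x H : sigma x H = sgn (form H (point x)).
Proof. exact/sideP/cell_point. Qed.

Fact face_of_subproof v : `[< cell [ffun H : hyperplanes A => sgn (form H v)] !=set0 >].
Proof. by apply/asboolP; exists v => H _; apply/sideP; rewrite ffunE. Qed.
Definition face_of v : face A := Face (face_of_subproof v).

Lemma sigma_face_of v H : sigma (face_of v) H = sgn (form H v).
Proof. by rewrite ffunE. Qed.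

Definition face_neg x := face_of (- point x).

Lemma sigma_neg x H : sigma (face_neg x) H = omap negb (sigma x H).
Proof. by rewrite sigma_face_of linearN sgnN -sigma_point. Qed.

Lemma sigma_mul x y H :
  sigma (mmul x y) H = if sigma x H is Some b then Some b else sigma y H.
Proof. by rewrite ffunE. Qed.

Lemma face_leP x y :
  reflect (forall H, sigma x H != None -> sigma y H = sigma x H) (x <= y)%O.
Proof.
apply: (iffP forallP) => xy H; have := xy H.
  by case: eqP => //= _ /eqP ->.
by case: eqP => //= _ /(_ isT)->.
Qed.

Lemma mem_supp x v :
  (v \in val (supp x)) <-> (forall H, sigma x H = None -> form H v = 0).
Proof.
split=> [xv H /mem_suppP/subvP/(_ v xv)|xv].
  by rewrite mem_hyperplane => /eqP.
rewrite memvE; apply/subv_bigcapP => H /eqP/xv vH.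
by rewrite -memvE mem_hyperplane vH.
Qed.

Lemma point_supp x : point x \in val (supp x).
Proof. by apply/mem_supp => H; rewrite sigma_point => /sgn0. Qed.

Lemma face_of_supp v X : (val (supp (face_of v)) <= val X)%VS = (v \in val X).
Proof.
have [x ->] := flatP X; apply/supp_leP/idP => [xv|/mem_supp xv H /xv vH].
  by apply/mem_supp => H /xv; rewrite sigma_face_of => /sgn0.
by rewrite sigma_face_of; apply/sgn0.
Qed.

Lemma supp_leW x y : (x <= y)%O -> (val (supp x) <= val (supp y))%VS.
Proof.
move=> /face_leP xy; apply/supp_leP => H yH.
by have := xy H; case: (sigma x H) => // b /(_ isT); rewrite yH.
Qed.

Lemma supp_eqP x y :
  (supp x = supp y) <-> (forall H, sigma x H = None <-> sigma y H = None).
Proof.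
split=> [xy H|xy].
  by split=> /mem_suppP; [rewrite xy|rewrite -xy] => /mem_suppP.
by apply/val_inj/eqP; rewrite eqEsubv; apply/andP; split; apply/supp_leP => H /xy.
Qed.

Lemma le_supp_eq x y : (x <= y)%O -> (val (supp y) <= val (supp x))%VS -> x = y.
Proof.
move=> /face_leP xy /supp_leP yx; apply: face_eqP => H.
have [xH|/eqP/xy -> //] := sigma x H =P None.
by rewrite xH yx.
Qed.

Lemma dim_supp_lt x y : (x < y)%O -> (\dim (val (supp x)) < \dim (val (supp y)))%N.
Proof.
rewrite lt_neqAle => /andP[xy le_xy]; rewrite ltn_neqAle dimvS ?supp_leW // andbT.
apply: contra xy => dxy; apply/eqP/(le_supp_eq le_xy).
by rewrite -(geq_leqif (dimv_leqif_sup (supp_leW le_xy))) (eqP dxy).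
Qed.
End Geometry.

(** * Walls *)

Section Walls.
Variables (R : realType) (d : nat) (A : arrangement R d).
Local Notation V := 'rV[R]_d.
Implicit Types (x y z w : face A) (H : hyperplanes A) (X Y : flats A) (v : V).

Lemma sgnM_pos (a b : R) : 0 < a -> sgn (a * b) = sgn b.
Proof. by move=> a0; rewrite /sgn pmulr_rgt0 // pmulr_rlt0. Qed.

Lemma sgnD (a b : R) : sgn a = sgn b -> sgn (a + b) = sgn a.
Proof.
case sa: (sgn a) => [[]|] /esym sb.
- by apply/sgn_pos/addr_gt0; apply/sgn_pos.
- by apply/sgn_neg/ltr_nDl; apply/sgn_neg.
- by apply/sgn0; rewrite (proj1 (sgn0 a) sa) add0r; apply/sgn0.
Qed.

(** The segment from a point of x to a point of y meets H. It does not cross the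
hyperplanes that do not separate x from y. *)
Lemma face_elimination x y H :
    sigma x H = Some true -> sigma y H = Some false ->
  exists2 z, sigma z H = None &
    forall K, sigma x K = sigma y K -> sigma z K = sigma x K.
Proof.
rewrite !sigma_point => /sgn_pos xH /sgn_neg yH.
(* The coefficients make the form of H vanish, and both are positive. *)
pose a : R := - form H (point y); pose b : R := form H (point x).
exists (face_of A (a *: point x + b *: point y)) => [|K].
  rewrite sigma_face_of linearD !linearZ /=; apply/sgn0.
  by rewrite /GRing.scale /= /a /b mulNr mulrC addrC subrr.
rewrite sigma_face_of !sigma_point linearD !linearZ /= => xyK.
have a0 : 0 < a by rewrite oppr_gt0.
by rewrite sgnD !sgnM_pos.
Qed.

(** Take a face y of maximal dimension in the intersection of X and H. If some
vector v of the intersection were not in supp y, the product of y with the face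
of v would have a larger support. *)
Lemma flat_cap X H : exists y, val (supp y) = (val X :&: val H)%VS.
Proof.
have one_in : (val (supp (mone : face A)) <= val X :&: val H)%VS.
  by rewrite subv_cap supp_one_le; apply/mem_suppP; rewrite ffunE.
pose P y := (val (supp y) <= val X :&: val H)%VS.
have [y yXH ymax] :=
  @arg_maxnP _ (mone : face A) P (fun y => \dim (val (supp y))) one_in.
exists y; apply/eqP; rewrite eqEsubv [X in X && _]yXH /=; apply/subvP => v.
rewrite memv_cap => /andP[vX vH].
pose z := mmul y (face_of A v).
have zXH : (val (supp z) <= val X :&: val H)%VS.
  have [yX yH] := andP (etrans (esym (subv_cap _ _ _)) yXH : is_true (_ && _)).
  rewrite subv_cap supp_mul_le yX face_of_supp vX /=.
  apply/mem_suppP; rewrite sigma_mul (mem_suppP _ _ yH) sigma_face_of.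
  by apply/sgn0/eqP; rewrite -mem_hyperplane.
have yz : (y <= z)%O.
  by apply/face_leP => K; rewrite sigma_mul; case: (sigma y K).
have yz_eq : val (supp y) = val (supp z).
  by apply/eqP; rewrite eqEdim supp_leW //; apply: ymax.
suff : v \in val (supp z) by rewrite -yz_eq.
apply/mem_supp => K; rewrite sigma_mul.
by case: (sigma y K) => // /[!sigma_face_of] /sgn0.
Qed.

(** U lies in the kernel of f on W, which is a proper subspace of W, so U is this
kernel by dimension. *)
Lemma mem_wall (U W : {vspace V}) (f : 'Hom(V, R^o)) v (u : V) :
    (U <= W)%VS -> \dim W = (\dim U).+1 -> {in U, forall p : V, f p = 0} ->
    v \in W -> f v != 0 -> u \in W -> f u = 0 -> u \in U.
Proof.
move=> UW dimW fU vW fv uW fu.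
have UWf : (U <= W :&: lker f)%VS.
  by rewrite subv_cap UW; apply/subvP => p /fU fp; rewrite memv_ker fp.
suff /eqP UE : U == (W :&: lker f)%VS.
  by rewrite UE memv_cap uW memv_ker fu eqxx.
rewrite eqEdim UWf -ltnS -dimW ltn_neqAle dimvS ?capvSl // andbT.
rewrite (dimv_leqif_eq (capvSl _ _)); apply: contra fv => /eqP WE.
by move: vW; rewrite -WE memv_cap memv_ker => /andP[].
Qed.

(** The condition on dimensions stands for the covering condition. A face y that
covers w with another jump of dimension would contribute nothing to the boundary
of w, since it lies in no summand of the next degree (see boundary_faceE). *)
Definition facet w y :=
  (w < y)%O && (\dim (val (supp y)) == (\dim (val (supp w))).+1).

Lemma facet_le w y : facet w y -> (w <= y)%O.
Proof. by case/andP=> /ltW. Qed.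

Lemma facet_dim w y :
  facet w y -> \dim (val (supp y)) = (\dim (val (supp w))).+1.
Proof. by case/andP => _ /eqP. Qed.

Lemma lt_separated x y :
  (x < y)%O -> exists2 H, sigma x H = None & sigma y H <> None.
Proof.
move=> xy; apply/exists2P/notP => noH.
have /(le_supp_eq (ltW xy)) xyE : (val (supp y) <= val (supp x))%VS.
  apply/supp_leP => H xH; apply: contrapT => yH; apply: noH.
  by exists H.
by move: xy; rewrite xyE ltxx.
Qed.

(** Two hyperplanes that contain w but not y meet supp y in the same subspace
supp w, so their forms are proportional on supp y: the sign of y at one of them
determines the sign at the other. *)
Lemma facet_side w y y' H :
    facet w y -> facet w y' -> supp y = supp y' -> sigma w H = None ->
    sigma y H <> None -> sigma y H = sigma y' H ->
  y = y'.
Proof.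
move=> wy wy' yy' wH yH yHE; apply: face_eqP => K.
have [wK|wK] := eqVneq (sigma w K) None; last first.
  rewrite (elimT (face_leP _ _) (facet_le wy) K wK).
  by rewrite (elimT (face_leP _ _) (facet_le wy') K wK).
have /supp_eqP sE := yy'.
have [yK|yK] := eqVneq (sigma y K) None; first by rewrite yK (proj1 (sE K) yK).
have y'K : sigma y' K != None by apply: contra yK => /eqP/sE ->.
have y'H : sigma y' H != None by rewrite -yHE; apply/eqP.
pose u := point y; pose u' := point y'.
have nz z L : sigma z L != None -> form L (point z) != 0.
  by apply: contra => /eqP/sgn0; rewrite -sigma_point => ->.
(* A vector of supp y on H, hence in supp w, hence on K. *)
pose t := form H u' *: u - form H u *: u'.
have tw : t \in val (supp w).
  apply: (mem_wall (supp_leW (facet_le wy)) (facet_dim wy) (f := form H) (v := u)).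
  - by move=> v /mem_supp; apply.
  - exact: point_supp.
  - by apply: nz; apply/eqP.
  - rewrite rpredB // rpredZ //; first exact: point_supp.
    by rewrite yy' point_supp.
  - by rewrite /t linearB !linearZ /= /GRing.scale /= mulrN mulrC subrr.
have /mem_supp/(_ K wK) := tw.
rewrite /t linearB !linearZ /= /GRing.scale /= mulrN => /eqP; rewrite subr_eq0 => /eqP tK.
have ratio : form K u / form K u' = form H u / form H u'.
  apply/eqP; rewrite eqr_div ?nz //; apply/eqP.
  by rewrite mulrC tK.
have := sgn_eqM (nz _ _ yK) (nz _ _ y'K).
rewrite -!sigma_point -/u -/u' ratio sgn_eqM ?nz //; last exact/eqP.
by rewrite -!sigma_point yHE eqxx; case: eqP.
Qed.
End Walls.

(** * Incidence numbers *)

Section Incidence.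
Variables (R : realType) (d : nat) (A : arrangement R d).
Local Notation V := 'rV[R]_d.
Implicit Types (x y z w : face A) (H : hyperplanes A) (X Y : flats A) (v : V).

Definition positive_basis (U : {vspace V}) (e : seq V -> int) : seq V :=
  xget [::] [set b | basis_of U b /\ e b = 1].

(** Negating one vector of a negatively oriented basis makes it positive. The zero
space has no vector to negate, and its empty basis may be negative: hence the
condition on the dimension. *)
Lemma positive_basisP U e : orientation U e ->
  basis_of U (positive_basis U e) /\
  ((0 < \dim U)%N -> e (positive_basis U e) = 1).
Proof.
move=> oe; rewrite /positive_basis.
case: xgetP => [b _ [] //|nob].
case dimU: (\dim U) => [|n].
  by rewrite basisEdim dimU /= andbT span_nil subv0 -dimv_eq0 dimU.
have Ub := vbasisP U; move: (vbasis U) Ub; rewrite dimU => b Ub.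
(* The diagonal matrix that negates the first basis vector. *)
pose r : 'rV[R]_n.+1 := \row_j (if j == 0 then -1 else 1).
have dr : \det (diag_mx r) = -1.
  rewrite det_diag big_ord_recl mxE eqxx big1 ?mulr1 // => i _.
  by rewrite mxE.
have [|i|Uc ec] := @orientation_change _ _ U e _ b
  [tuple r 0 i *: b`_i | i < n.+1] (diag_mx r) oe Ub.
- by rewrite dr oppr_eq0 oner_eq0.
- rewrite -tnth_nth tnth_mktuple (bigD1 i) //= !mxE eqxx mulr1n big1 ?addr0 //.
  by move=> j ji; rewrite !mxE [i == j]eq_sym (negPf ji) mulr0n scale0r.
have [[eb|eb] _] : (e b = 1 \/ e b = -1) /\ True.
- split=> //; have /eqP := orientation_sqr oe Ub.
  by rewrite -expr2 sqrf_eq1 => /orP[/eqP|/eqP]; [left|right].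
- by exfalso; apply: (nob b); split.
- exfalso; apply: (nob [tuple r 0 i *: b`_i | i < n.+1]); split=> //.
  by rewrite ec dr eb sgzN sgz1.
Qed.

Variables (eps : flats A -> seq V -> int).
Hypothesis heps : forall Y, orientation (val Y) (eps Y).

Let pb X := positive_basis (val X) (eps X).
Let pbP X : basis_of (val X) (pb X).
Proof. by have [] := positive_basisP (@heps X). Qed.

Lemma incidenceE x y : incidence eps x y = eps (supp y) (rcons (pb (supp x)) (point y)).
Proof. by []. Qed.

Lemma point_notin_supp w v H :
  sigma w H = None -> form H v != 0 -> v \notin val (supp w).
Proof. by move=> wH; apply: contra => /mem_supp/(_ H wH) ->; rewrite eqxx. Qed.

Lemma form_point_neq0 y H : (form H (point y) != 0) = (sigma y H != None).
Proof.
rewrite sigma_point; congr negb.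
by apply/eqP/eqP => [/sgn0|/(proj1 (sgn0 _))].
Qed.

(** Modulo supp w the vector v' is a multiple of v, and the sign of the factor is
read off from any hyperplane that contains w but not v. *)
Lemma eps_side w y H (b : seq V) (v v' : V) : facet w y ->
    sigma w H = None -> basis_of (val (supp w)) b ->
    v \in val (supp y) -> v' \in val (supp y) ->
    form H v != 0 -> form H v' != 0 ->
  eps (supp y) (rcons b v')
  = (if sgn (form H v') == sgn (form H v) then 1 else -1) * eps (supp y) (rcons b v).
Proof.
move=> wy wH wb yv yv' vH v'H.
have le_wy := supp_leW (facet_le wy); have dwy := facet_dim wy.
rewrite -sgn_eqM //; set a := form H v' / form H v.
have a0 : a != 0 by rewrite mulf_neq0 // invr_eq0.
apply: (orientation_last (@heps _) le_wy dwy wb yv (u := v' - a *: v)) => //.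
- exact: point_notin_supp wH vH.
- apply: (mem_wall le_wy dwy (f := form H) _ yv vH).
  + by move=> p /mem_supp; apply.
  + by rewrite rpredB // rpredZ.
  + by rewrite linearB linearZ /= /GRing.scale /= divfK // subrr.
- by rewrite subrK.
Qed.

Lemma incidence_side w y w' y' H : facet w y ->
    supp w = supp w' -> supp y = supp y' ->
    sigma w H = None -> sigma y H <> None ->
  incidence eps w' y'
  = (if sigma y' H == sigma y H then 1 else -1) * incidence eps w y.
Proof.
move=> wy ww' yy' wH /eqP yH.
have y'H : sigma y' H != None.
  by apply: contra yH => /eqP/(proj2 (proj1 (supp_eqP _ _) yy' H)) ->.
rewrite !incidenceE -ww' -yy' !sigma_point.
apply: (eps_side wy wH (pbP _) (point_supp y)); rewrite ?form_point_neq0 //.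
by rewrite yy' point_supp.
Qed.

Lemma incidence_sqr w y : facet w y -> incidence eps w y * incidence eps w y = 1.
Proof.
move=> wy; rewrite incidenceE; apply: (orientation_sqr (@heps _)).
have [H wH yH] := lt_separated (proj1 (andP wy)).
apply: (basis_rcons (supp_leW (facet_le wy)) (facet_dim wy) (pbP _)).
  exact: point_supp.
by apply: (point_notin_supp wH); rewrite form_point_neq0; apply/eqP.
Qed.

(** Let b be the basis chosen for supp x. A point of y' lies on the same side of y
as z does, so the left hand side is the orientation of supp z on b followed by a
point of y and a point of y'; the right hand side is obtained by swapping the
two points. *)
Lemma incidence_diamond x y y' z : facet x y -> facet x y' ->
    facet y z -> facet y' z -> y != y' ->
  incidence eps x y * incidence eps y z
  = - (incidence eps x y' * incidence eps y' z).
Proof.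
have main u u' : facet x u -> facet x u' -> facet u z -> facet u' z -> u != u' ->
    incidence eps x u * incidence eps u z
    = eps (supp z) (rcons (rcons (pb (supp x)) (point u)) (point u'))
    /\ basis_of (val (supp z)) (rcons (rcons (pb (supp x)) (point u)) (point u')).
  move=> xu xu' uz u'z uu'.
  have [H uH u'H] : exists2 H, sigma u H = None & sigma u' H <> None.
    apply/exists2P/notP => noH; case/eqP: uu'.
    have u'u : (val (supp u') <= val (supp u))%VS.
      apply/supp_leP => H uH; apply: contrapT => u'H; apply: noH.
      by exists H.
    have /eqP su : supp u' == supp u.
      by rewrite -(inj_eq val_inj) eqEdim u'u (facet_dim xu) (facet_dim xu') leqnn.
    have /esym/supp_eqP sE := su.
    apply: face_eqP => H.
    have [uH|uH] := eqVneq (sigma u H) None.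
      by rewrite uH (proj1 (sE H) uH).
    have u'H : sigma u' H != None.
      by apply: contra uH => /eqP/sE ->.
    rewrite -(elimT (face_leP _ _) (facet_le uz) H uH).
    by rewrite (elimT (face_leP _ _) (facet_le u'z) H u'H).
  have [K xK uK] := lt_separated (proj1 (andP xu)).
  have xu_le := supp_leW (facet_le xu).
  have uz_le := supp_leW (facet_le uz).
  have u'z_le := supp_leW (facet_le u'z).
  have zu' : point u' \in val (supp z) by apply/(subvP u'z_le)/point_supp.
  have nu : point u \notin val (supp x).
    by apply: (point_notin_supp xK); rewrite form_point_neq0; apply/eqP.
  have nu' : point u' \notin val (supp u).
    by apply: (point_notin_supp uH); rewrite form_point_neq0; apply/eqP.
  have ub : basis_of (val (supp u)) (rcons (pb (supp x)) (point u)).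
    exact: (basis_rcons xu_le (facet_dim xu) (pbP _) (point_supp _)).
  split; last exact: (basis_rcons uz_le (facet_dim uz) ub).
  have u'HE : sigma z H = sigma u' H.
    by apply: (elimT (face_leP _ _) (facet_le u'z)); apply/eqP.
  have u'H0 : form H (point u') != 0 by rewrite form_point_neq0; apply/eqP.
  have zH0 : form H (point z) != 0 by rewrite form_point_neq0 u'HE; apply/eqP.
  rewrite (incidenceE u z) (eps_side uz uH (pbP _) zu' (point_supp z) u'H0 zH0).
  rewrite -!sigma_point u'HE eqxx mul1r.
  have d0 : eps (supp u) (pb (supp u)) = 1.
    by have [_ ->] := positive_basisP (@heps (supp u)); rewrite ?(facet_dim xu).
  rewrite incidenceE -[X in _ * X]mul1r -d0.
  rewrite -(orientation_init (@heps _) (@heps _) uz_le (facet_dim uz) (pbP _) ub zu' nu').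
  by rewrite mulrA (orientation_sqr (@heps _) ub) mul1r.
move=> xy xy' yz y'z yy'.
have [-> zb] := main y y' xy xy' yz y'z yy'.
have [-> _] := main y' y xy' xy y'z yz (etrans (esym (congr1 negb (eq_sym y y'))) yy').
by rewrite (orientation_swap (@heps _) zb) opprK.
Qed.
End Incidence.

(** * Intervals of length two *)

Section Diamond.
Variables (R : realType) (d : nat) (A : arrangement R d).
Local Notation V := 'rV[R]_d.
Implicit Types (x y z w : face A) (H : hyperplanes A) (X Y : flats A) (v : V).

Lemma sg_mul_gt0 (a b : R) : a != 0 -> (0 < Num.sg a * b) = (sgn b == sgn a).
Proof.
rewrite /sgn; case: (ltrgt0P a) => // a0 _.
  by rewrite gtr0_sg // mul1r; case: ltrgt0P.
by rewrite ltr0_sg // mulN1r oppr_gt0; case: ltrgt0P.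
Qed.

Lemma sg_mul_eq0 (a b : R) : a != 0 -> (Num.sg a * b == 0) = (b == 0).
Proof. by move=> a0; rewrite mulf_eq0 sgr_eq0 (negPf a0). Qed.

(** Modulo supp x, the face z is an open cone in a plane, bounded by two rays. To
find them, normalize the forms of the hyperplanes through x that miss z so that
they are positive at a point p of z, and let f be their sum. As f is positive on
z and on every face strictly between x and z, each such face meets, modulo
supp x, the affine line p + t q, where f q = 0. The normalized forms are all
positive for t = 0 and their coefficients along q add up to 0 without all
vanishing, so they are nonnegative exactly on a compact interval around 0. The
faces between x and z pass through its two ends. *)
Section Between.
Variables (x z : face A).
Hypothesis xz : (x < z)%O.
Hypothesis dxz : \dim (val (supp z)) = (\dim (val (supp x))).+2.

Let p := point z.
Let away := [pred H | (sigma x H == None) && (sigma z H != None)].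
Let g H v : R := Num.sg (form H p : R) * (form H v : R).
Let f : 'Hom(V, R^o) := \sum_(H | away H) Num.sg (form H p) *: form H.

Let fE v : f v = \sum_(H | away H) g H v.
Proof. by rewrite sum_lfunE; apply: eq_bigr => H _; rewrite lfunE. Qed.

Let gp0 H : away H -> 0 < g H p.
Proof.
by case/andP=> _ zH; rewrite sg_mul_gt0 ?eqxx // form_point_neq0.
Qed.

Let fp0 : 0 < f p.
Proof.
have [H xH zH] := lt_separated xz; have aH : away H by rewrite /= xH eqxx; apply/eqP.
rewrite fE (bigD1 H) //= ltr_pwDl ?gp0 //.
by apply: sumr_ge0 => K /andP[aK _]; apply/ltW/gp0.
Qed.

Let exists_dir : exists q, [/\ q \in val (supp z), f q = 0 & q \notin val (supp x)].
Proof.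
have /subvPn[q] : ~~ (val (supp z) :&: lker f <= val (supp x))%VS.
  apply/negP => /dimvS; apply/negP; rewrite -ltnNge.
  have := limg_ker_dim f (val (supp z)); rewrite dxz.
  have : (\dim (f @: val (supp z)) <= 1)%N.
    by rewrite (leq_trans (dimvS (subvf _))) // dimvf.
  move=> i1 e; rewrite -(ltn_add2r (\dim (f @: val (supp z)))) e.
  by rewrite -addn2 ltn_add2l ltnS.
rewrite memv_cap memv_ker => /andP[zq /eqP fq] xq.
by exists q.
Qed.

(** The product with x restores the signs of z at the hyperplanes that miss x. *)
Let ray (q : V) (t : R) := mmul x (face_of A (p + t *: q)).

(** The parameters of the ends of the interval. *)
Let critical (q : V) (t : R) :=
  (forall H, away H -> 0 <= g H (p + t *: q)) /\
  exists2 H, away H & g H (p + t *: q) = 0.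

Let gD H (q : V) (t : R) : g H (p + t *: q) = g H p + t * g H q.
Proof.
by rewrite /g linearD linearZ /= mulrDr /GRing.scale /= mulrCA.
Qed.

Let sgn_g H v : away H -> (sgn (form H v) == sigma z H) = (0 < g H v).
Proof.
by case/andP=> _ zH; rewrite /g sg_mul_gt0 ?form_point_neq0 // -sigma_point.
Qed.

Let sgn_g0 H v : away H -> (sgn (form H v) == None) = (g H v == 0).
Proof.
case/andP=> _ zH; rewrite /g sg_mul_eq0 ?form_point_neq0 //.
by apply/eqP/eqP => [/sgn0|/(proj2 (sgn0 _))].
Qed.

Let critical_between (q : V) (t : R) : q \in val (supp z) -> f q = 0 -> critical q t ->
  (x < ray q t < z)%O.
Proof.
move=> zq fq [tge [K aK K0]].
have rayE H : sigma x H = None -> sigma (ray q t) H = sgn (form H (p + t *: q)).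
  by move=> xH; rewrite sigma_mul xH sigma_face_of.
have xr : (x <= ray q t)%O.
  by apply/face_leP => H; rewrite sigma_mul; case: (sigma x H).
have rz : (ray q t <= z)%O.
  apply/face_leP => H; rewrite sigma_mul; case xH: (sigma x H) => [b|].
    by move=> _; rewrite (elimT (face_leP x z) (ltW xz)) xH.
  rewrite sigma_face_of => rH; apply/esym/eqP; move: rH.
  have [zH|zH] := eqVneq (sigma z H) None.
    case/eqP; apply/sgn0; rewrite linearD linearZ /=.
    rewrite (proj1 (mem_supp z q) zq H zH) scaler0 addr0.
    by apply: (proj1 (mem_supp z _) (point_supp z) H zH).
  have aH : away H by rewrite /= xH zH.
  by rewrite sgn_g0 // sgn_g // lt_neqAle eq_sym tge // andbT.
rewrite !lt_neqAle xr rz !andbT; apply/andP; split; apply/eqP.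
  move=> xrE; suff : f (p + t *: q) = 0.
    by rewrite linearD linearZ /= fq scaler0 addr0 => fp; move: fp0; rewrite fp ltxx.
  rewrite fE big1 // => H aH; apply/eqP; rewrite -sgn_g0 //.
  have /andP[/eqP xH _] := aH.
  by rewrite -rayE // -xrE xH.
move=> rzE; have /andP[/eqP xK /eqP[]] := aK.
by rewrite -rzE rayE //; apply/eqP; rewrite sgn_g0 // K0.
Qed.

Let critical_exists (q : V) : q \in val (supp z) -> f q = 0 -> q \notin val (supp x) ->
  exists2 t : R, 0 < t & critical q t.
Proof.
move=> zq fq xq.
pose down H := away H && (g H q < 0).
have [H0 dH0] : exists H, down H.
  apply: contrapT => /forallNP nodown; case/negP: xq; apply/mem_supp => H xH.
  have gge K : away K -> 0 <= g K q.
    by move=> aK; have /negP := nodown K; rewrite /down aK /= -leNgt.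
  have [zH|zH] := eqVneq (sigma z H) None.
    exact: (proj1 (mem_supp z q) zq H zH).
  have aH : away H by rewrite /= xH zH.
  have /eqP := fq; rewrite fE psumr_eq0 // => /allP/(_ H).
  by rewrite mem_index_enum aH /= -sgn_g0 // => /(_ isT)/eqP/sgn0.
(* The end in the direction of q is the first zero of a decreasing form. *)
case: (@arg_minP _ _ _ H0 down (fun H => g H p / - g H q) dH0) => K dK Kmin.
have /andP[aK Kneg] := dK.
exists (g K p / - g K q); first by rewrite divr_gt0 ?gp0 // oppr_gt0.
split=> [H aH|]; last first.
  exists K => //; apply: (etrans (gD K q _)).
  by rewrite invrN mulrN mulNr divfK ?subrr // lt_eqF.
rewrite gD; have [Hneg|Hpos] := ltP (g H q) 0.
  have dH : down H by rewrite /down aH.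
  have := Kmin H dH; rewrite ler_pdivlMr ?oppr_gt0 // mulrN.
  by rewrite lerNl -subr_ge0 opprK addrC.
rewrite addr_ge0 ?(ltW (gp0 aH)) // mulr_ge0 // divr_ge0 ?(ltW (gp0 aK)) //.
by rewrite oppr_ge0 ltW.
Qed.

Let critical_le (q : V) (t t' : R) :
  0 < t -> 0 < t' -> critical q t -> critical q t' -> t' <= t.
Proof.
move=> t0 t'0 [_ [K aK K0]] [t'ge _]; move: K0; rewrite gD => K0.
have := t'ge K aK; have := gp0 aK; rewrite gD.
rewrite leNgt => gK t'K; apply/negP => tt'.
(* The form of K vanishes at the end t, so it decreases along q and is negative
   beyond t. *)
have gq : g K q < 0 by nra.
nra.
Qed.

Let between_critical (q : V) y : q \in val (supp z) -> f q = 0 -> q \notin val (supp x) ->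
  facet x y -> facet y z -> exists2 t, critical q t & y = ray q t.
Proof.
move=> zq fq xq xy yz; pose u := point y.
have le_xy := facet_le xy; have le_yz := facet_le yz.
have aNone H : away H -> sigma x H = None by case/andP=> /eqP.
have yaway H : away H -> sigma y H != None -> sigma y H = sigma z H.
  by move=> _ yH; rewrite (elimT (face_leP y z) le_yz).
have gu H : away H -> 0 <= g H u.
  move=> aH; rewrite le_eqVlt [0 == _]eq_sym -sgn_g0 // -sgn_g // -sigma_point.
  by case: eqP => //= /eqP yH; rewrite yaway.
have fu : 0 < f u.
  have [H xH yH] := lt_separated (proj1 (andP xy)).
  have zH : sigma z H = sigma y H by apply: (elimT (face_leP y z) le_yz); apply/eqP.
  have aH : away H by rewrite /= xH zH eqxx; apply/eqP.
  rewrite fE (bigD1 H) //= ltr_pwDl //.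
    by rewrite -sgn_g // -sigma_point zH.
  by apply: sumr_ge0 => K /andP[aK _]; apply: gu.
pose a := f u / f p; have a0 : 0 < a by rewrite divr_gt0.
pose U := (val (supp x) + <[q]>)%VS.
have zx : (val (supp x) <= val (supp z))%VS by rewrite supp_leW // ltW.
have fx v : v \in val (supp x) -> f v = 0.
  move/mem_supp=> vx; rewrite fE big1 // => H /aNone/vx.
  by rewrite /g => ->; rewrite mulr0.
have /memv_addP[u0 u0x [_ /vlineP[b ->]] uE] : u - a *: p \in U.
  apply: (@mem_wall _ _ U (val (supp z)) f p).
  - by rewrite /U subv_add zx -memvE.
  - rewrite dxz /U dimv_disjoint_sum ?dim_vline; last first.
      apply/eqP; rewrite -subv0; apply/subvP => v; rewrite memv_cap => /andP[vx].
      case/vlineP=> c vE; move: vx; rewrite vE.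
      have [->|c0] := eqVneq c 0; first by rewrite scale0r !mem0v.
      by rewrite rpredZeq (negPf c0) (negPf xq).
    rewrite (_ : q != 0) ?addn1 //.
    by apply: contra xq => /eqP ->; rewrite mem0v.
  - move=> _ /memv_addP[v vx [_ /vlineP[c ->]] ->].
    by rewrite linearD linearZ /= fx // fq scaler0 addr0.
  - exact: point_supp.
  - by rewrite gt_eqF.
  - rewrite rpredB ?rpredZ ?point_supp //.
    by apply: (subvP (supp_leW le_yz)); apply: point_supp.
  - by rewrite linearB linearZ /= /GRing.scale /= divfK ?subrr // gt_eqF.
have rayE H : sigma x H = None -> sgn (form H (p + (b / a) *: q)) = sigma y H.
  move=> xH; rewrite sigma_point -/u.
  have -> : u = a *: (p + (b / a) *: q) + u0.
    rewrite scalerDr scalerA mulrCA divff ?gt_eqF // mulr1.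
    by rewrite -addrA [_ + u0]addrC -uE addrC subrK.
  rewrite [in RHS]linearD /= (proj1 (mem_supp x u0) u0x H xH) addr0 linearZ /=.
  by rewrite /GRing.scale /= sgnM_pos.
exists (b / a).
  split=> [H aH|].
    rewrite le_eqVlt [0 == _]eq_sym -sgn_g0 // -sgn_g // rayE ?aNone //.
    by case: eqP => //= /eqP yH; rewrite yaway.
  have [H yH zH] := lt_separated (proj1 (andP yz)).
  have xH : sigma x H = None by apply: (elimT (supp_leP x y)) yH; rewrite supp_leW.
  have aH : away H by rewrite /= xH eqxx; apply/eqP.
  by exists H => //; apply/eqP; rewrite -sgn_g0 // rayE // yH.
apply: face_eqP => H; rewrite sigma_mul; case xH: (sigma x H) => [c|].
  by rewrite (elimT (face_leP x y) le_xy) xH.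
by rewrite sigma_face_of rayE.
Qed.

Lemma between_diamond : exists y1 y2, [/\ y1 != y2, facet x y1 /\ facet y1 z,
   facet x y2 /\ facet y2 z &
   forall y, facet x y -> facet y z -> y = y1 \/ y = y2].
Proof.
have [q [zq fq xq]] := exists_dir.
have zNq : - q \in val (supp z) by rewrite rpredN.
have fNq : f (- q) = 0 by rewrite linearN /= fq oppr0.
have xNq : - q \notin val (supp x) by rewrite rpredN.
have [t1 t1_gt0 c1] := critical_exists zq fq xq.
have [t2 t2_gt0 c2] := critical_exists zNq fNq xNq.
have facets y : (x < y < z)%O -> facet x y /\ facet y z.
  case/andP=> xy yz; rewrite /facet xy yz /= dxz.
  have := dim_supp_lt xy; have := dim_supp_lt yz; rewrite dxz => h1 h2.
  suff -> : \dim (val (supp y)) = (\dim (val (supp x))).+1 by rewrite !eqxx.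
  by apply/eqP; rewrite eqn_leq h2 -ltnS h1.
exists (ray q t1), (ray (- q) t2); split.
- have [_ [K aK K0]] := c1; have /andP[/eqP xK _] := aK.
  apply/eqP => /(congr1 (fun y => sigma y K)).
  rewrite !sigma_mul xK !sigma_face_of => E.
  have : sgn (form K (p + t1 *: q)) == None by rewrite sgn_g0 // K0.
  rewrite E sgn_g0 // gD => /eqP; have := gp0 aK.
  have -> : g K (- q) = - g K q by rewrite /g linearN mulrN.
  move: K0; rewrite gD => K0 gK K0'.
  nra.
- exact/facets/critical_between.
- exact/facets/critical_between.
move=> y xy yz; have [t ct ->] := between_critical zq fq xq xy yz.
have [t0|t0|t0] := ltrgt0P t.
- by left; congr (ray q _); apply/le_anti/andP; split; apply: (@critical_le q).
- right; have ct' : critical (- q) (- t).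
    by rewrite /critical scalerN scaleNr opprK.
  have tE : - t = t2.
    by apply/le_anti/andP; split; apply: (@critical_le (- q)); rewrite ?oppr_gt0.
  by rewrite /ray -tE scalerN scaleNr opprK.
- have [_ [K aK]] := ct; rewrite t0 scale0r addr0 => gK.
  by have := gp0 aK; rewrite gK ltxx.
Qed.
End Between.
End Diamond.

(** * The boundary on functions on faces *)

Section Chains.
Variables (k : fieldType) (R : realType) (d : nat) (A : arrangement R d).
Local Notation V := 'rV[R]_d.
Local Notation F := (face A).
Implicit Types (x y z w : F) (H K : hyperplanes A) (X Y Z : flats A).
Variables (eps : flats A -> seq V -> int).
Hypothesis heps : forall Y, orientation (val Y) (eps Y).
Local Notation inc := (incidence eps).

Lemma supp_le_flatP w X :
  reflect (forall H, (val X <= val H)%VS -> sigma w H = None)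
          (val (supp w) <= val X)%VS.
Proof.
apply: (iffP idP); have [x ->] := flatP X.
  by move=> /supp_leP wx H /mem_suppP/wx.
by move=> wx; apply/supp_leP => H /mem_suppP/wx.
Qed.

(** Around w this is the face opposite to y: signs are kept at the hyperplanes that
do not contain w and reversed at the others. *)
Definition reflect_face w y := mmul w (face_neg y).

Lemma sigma_reflect w y H : sigma w H = None ->
  sigma (reflect_face w y) H = omap negb (sigma y H).
Proof. by move=> wH; rewrite sigma_mul wH sigma_neg. Qed.

Lemma reflect_supp w y : (w <= y)%O -> supp (reflect_face w y) = supp y.
Proof.
move=> /face_leP wy; apply/supp_eqP => H; rewrite sigma_mul sigma_neg.
have := wy H; case: (sigma w H) => [b /(_ isT) ->|_] //=.
by case: (sigma y H).
Qed.

Lemma reflect_facet w y : facet w y -> facet w (reflect_face w y).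
Proof.
move=> wy; have le_wy := facet_le wy.
rewrite /facet reflect_supp // (facet_dim wy) eqxx andbT lt_neqAle.
have -> : (w <= reflect_face w y)%O.
  by apply/face_leP => H; rewrite sigma_mul; case: (sigma w H).
rewrite andbT; apply: contra_eqN (facet_dim wy) => /eqP wE.
by rewrite -(reflect_supp le_wy) -wE neq_ltn ltnSn.
Qed.

Lemma reflectK w y : (w <= y)%O -> reflect_face w (reflect_face w y) = y.
Proof.
move=> /face_leP wy; apply: face_eqP => H.
rewrite sigma_mul sigma_neg sigma_mul sigma_neg.
have := wy H; case: (sigma w H) => [b /(_ isT) ->|_] //=.
by case: (sigma y H) => [[]|].
Qed.

(** Reflection in w permutes the faces of support Z around w without fixed point
and reverses their incidence numbers. Splitting the sum by the sign at one
hyperplane, instead of doubling it, keeps the argument valid in characteristic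
2. *)
Lemma wall_cancel (M : zmodType) w Z (g : F -> M) :
    (forall y, facet w y -> supp y = Z -> g (reflect_face w y) = g y) ->
  \sum_(y | facet w y && (supp y == Z)) g y *~ inc w y = 0.
Proof.
move=> gE; have [/existsP[y0 /andP[wy0 /eqP y0Z]]|] :=
  boolP [exists y, facet w y && (supp y == Z)]; last first.
  move=> no; apply: big_pred0 => y; apply: contraNF no => yP.
  by apply/existsP; exists y.
have [H wH y0H] := lt_separated (proj1 (andP wy0)).
have yHN y : supp y = Z -> sigma y H <> None.
  by rewrite -y0Z => /supp_eqP yy0 /yy0.
rewrite (bigID (fun y => sigma y H == Some true)) /=.
rewrite [X in _ + X](reindex_onto (reflect_face w) (reflect_face w)) /=; last first.
  by move=> y /andP[/andP[/facet_le wy _] _]; apply: reflectK.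
rewrite [X in _ + X](eq_bigl (fun y =>
    [&& facet w y, supp y == Z & sigma y H == Some true])); last first.
  move=> y; apply/idP/idP.
    case/andP=> /andP[/andP[wry /eqP rZ] rH] /eqP ry.
    have wy : facet w y by rewrite -ry; apply: reflect_facet.
    have yZ : supp y = Z by rewrite -(reflect_supp (facet_le wy)).
    rewrite wy yZ eqxx /=; move: rH; rewrite sigma_reflect //.
    by have := yHN y yZ; case: (sigma y H) => [[]|].
  case/and3P=> wy /eqP yZ /eqP yH.
  rewrite reflect_facet // reflect_supp ?facet_le // yZ eqxx.
  by rewrite reflectK ?facet_le // eqxx sigma_reflect // yH.
rewrite [X in X + _](eq_bigl (fun y =>
    [&& facet w y, supp y == Z & sigma y H == Some true])); last first.
  by move=> y; rewrite andbA.
rewrite -big_split big1 //= => y /and3P[wy /eqP yZ /eqP yH].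
have yry : supp y = supp (reflect_face w y) by rewrite reflect_supp ?facet_le.
have -> : inc w (reflect_face w y) = - inc w y.
  rewrite (incidence_side heps wy (erefl _) yry wH); last by rewrite yH.
  by rewrite sigma_reflect // yH /= mulN1r.
by rewrite gE // mulrNz subrr.
Qed.

Definition cell_boundary (c : F -> k) y : k := \sum_(w | facet w y) c w *~ inc w y.

Lemma eq_cell_boundary c c' y :
  (forall w, facet w y -> c w = c' w) -> cell_boundary c y = cell_boundary c' y.
Proof. by move=> cc'; apply: eq_bigr => w /cc'->. Qed.

Lemma cell_boundaryD c c' y :
  cell_boundary (fun w => c w + c' w) y = cell_boundary c y + cell_boundary c' y.
Proof. by rewrite /cell_boundary -big_split; apply: eq_bigr => w _; rewrite mulrzDl. Qed.

Lemma cell_boundaryB c c' y :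
  cell_boundary (fun w => c w - c' w) y = cell_boundary c y - cell_boundary c' y.
Proof. by rewrite /cell_boundary -sumrB; apply: eq_bigr => w _; rewrite mulrzBl. Qed.

Lemma cell_boundary_eq0 c y : (forall w, facet w y -> c w = 0) -> cell_boundary c y = 0.
Proof. by move=> c0; rewrite /cell_boundary big1 // => w /c0 ->; rewrite mul0rz. Qed.

(** The coefficient of z collects, for each face x two dimensions below z, the
incidence products along the two faces between x and z; they are opposite. *)
Lemma cell_boundary2 c z : cell_boundary (cell_boundary c) z = 0.
Proof.
rewrite /cell_boundary; under eq_bigr => y _ do rewrite mulrz_suml.
rewrite (exchange_big_dep predT) //= big1 // => x _.
under eq_bigr => y _ do rewrite -mulrzA.
rewrite -mulrz_sumr.
suff -> : \sum_(y | facet y z && facet x y) inc x y * inc y z = 0 by rewrite mulr0z.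
have [/existsP[y0 /andP[y0z xy0]]|] :=
  boolP [exists y, facet y z && facet x y]; last first.
  move=> no; apply: big_pred0 => y; apply: contraNF no => yP.
  by apply/existsP; exists y.
have xz : (x < z)%O := lt_trans (proj1 (andP xy0)) (proj1 (andP y0z)).
have dxz : \dim (val (supp z)) = (\dim (val (supp x))).+2.
  by rewrite (facet_dim y0z) (facet_dim xy0).
have [y1 [y2 [y12 [xy1 y1z] [xy2 y2z] yE]]] := between_diamond xz dxz.
rewrite (bigD1 y1) /= ?y1z // (bigD1 y2) /=; last by rewrite y2z xy2 eq_sym.
rewrite big1 ?addr0.
  by rewrite (incidence_diamond heps xy1 xy2 y1z y2z y12) addNr.
move=> y /andP[/andP[/andP[yz xy] yy1] yy2].
by case: (yE y xy yz) => yyE; move: yy1 yy2; rewrite yyE eqxx.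
Qed.

Definition top_sum X (c : F -> k) : k := \sum_(y | supp y == X) c y.

Lemma sum_cell_boundary (P : pred F) c :
  \sum_(y | P y) cell_boundary c y = \sum_w c w *~ \sum_(y | facet w y && P y) inc w y.
Proof.
rewrite /cell_boundary (exchange_big_dep predT) //=; apply: eq_bigr => w _.
by rewrite -mulrz_sumr; congr (_ *~ _); apply: eq_bigl => y; rewrite andbC.
Qed.

(** The two faces on either side of a wall have opposite incidence numbers. *)
Lemma sum_wall w X : \sum_(y | facet w y && (supp y == X)) inc w y = 0.
Proof.
rewrite -[RHS](@wall_cancel int w X (fun _ => 1)) //.
by apply: eq_bigr => y _; rewrite intz.
Qed.

Lemma top_sum_boundary X c : top_sum X (cell_boundary c) = 0.
Proof. by rewrite /top_sum sum_cell_boundary big1 // => w _; rewrite sum_wall mulr0z. Qed.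
End Chains.

(** * Exactness on convex regions *)

Section Exactness.
Variables (k : fieldType) (R : realType) (d : nat) (A : arrangement R d).
Local Notation V := 'rV[R]_d.
Local Notation F := (face A).
Implicit Types (x y z w : F) (H K : hyperplanes A) (X Y Z : flats A).
Implicit Types (c b : F -> k) (t : hyperplanes A -> option bool).
Variables (eps : flats A -> seq V -> int).
Hypothesis heps : forall Y, orientation (val Y) (eps Y).
Local Notation inc := (incidence eps).
Local Notation cell_boundary := (@cell_boundary k R d A eps).

(** The signs prescribed by t cut out an open convex cone of X; the value None
prescribes nothing. *)
Definition region X t w :=
  (val (supp w) <= val X)%VS &&
  [forall H, (t H == None) || (sigma w H == t H)].

Lemma regionP X t w :
  reflect ((val (supp w) <= val X)%VS /\ forall H, t H <> None -> sigma w H = t H)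
          (region X t w).
Proof.
apply: (iffP andP) => -[wX /= tw]; split=> //.
  by move=> H /eqP tH; have := forallP tw H; rewrite (negPf tH) => /eqP.
by apply/forallP=> H; case: eqP => //= /tw ->.
Qed.

Lemma region_le X t w y :
  region X t w -> (w <= y)%O -> (val (supp y) <= val X)%VS -> region X t y.
Proof.
move=> /regionP[_ tw] /face_leP wy yX; apply/regionP; split=> // H tH.
by rewrite wy tw //; apply/eqP.
Qed.

Definition refine t H s : hyperplanes A -> option bool :=
  fun K => if K == H then Some s else t K.

Lemma region_refine X t H s w : t H = None ->
  region X (refine t H s) w = region X t w && (sigma w H == Some s).
Proof.
move=> tH; apply/regionP/andP => [[wX tw]|[/regionP[wX tw] /eqP wH]].
  split; last by rewrite tw /refine eqxx.
  apply/regionP; split=> // K tK; rewrite tw /refine; case: eqP => // KH.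
  by case: tK; rewrite KH.
split=> // K; rewrite /refine; case: eqP => [->|_] //; exact: tw.
Qed.

(** The hyperplanes that may still cut the region. Their number decreases both on
the section by one of them and on the two halves. *)
Definition free_hyperplanes X t :=
  [pred H | ~~ (val X <= val H)%VS & t H == None].

Lemma free_refine X t H s : ~~ (val X <= val H)%VS -> t H = None ->
  (#|free_hyperplanes X (refine t H s)| < #|free_hyperplanes X t|)%N.
Proof.
move=> XH tH; apply/proper_card/properP; split.
  apply/fintype.subsetP => K; rewrite !inE /refine => /andP[-> /=].
  by case: (K =P H).
by exists H; rewrite !inE XH ?tH // /refine eqxx.
Qed.

Lemma free_cut X X' t H : ~~ (val X <= val H)%VS -> t H = None ->
    val X' = (val X :&: val H)%VS ->
  (#|free_hyperplanes X' t| < #|free_hyperplanes X t|)%N.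
Proof.
move=> XH tH X'E; apply/proper_card/properP; split.
  apply/fintype.subsetP => K; rewrite !inE => /andP[X'K ->]; rewrite andbT.
  by apply: contra X'K => XK; rewrite X'E (subv_trans (capvSl _ _)).
by exists H; rewrite !inE ?XH ?tH // X'E capvSr.
Qed.

Section Cut.
Variables (X X' : flats A) (H : hyperplanes A).
Hypothesis XH : ~~ (val X <= val H)%VS.
Hypothesis X'E : val X' = (val X :&: val H)%VS.

Lemma cut_dim : \dim (val X) = (\dim (val X')).+1.
Proof.
have := limg_ker_dim (form H) (val X).
rewrite lker_form -X'E => <-.
have le1 : (\dim (form H @: val X) <= 1)%N.
  by rewrite (leq_trans (dimvS (subvf _))) // dimvf.
suff : (0 < \dim (form H @: val X))%N.
  by move: le1; case: (\dim _) => [|[]] // _ _; rewrite addn1.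
rewrite lt0n dimv_eq0; apply: contra XH; rewrite -lkerE.
by rewrite lker_form.
Qed.

Lemma supp_le_cut w :
  (val (supp w) <= val X')%VS = (val (supp w) <= val X)%VS && (sigma w H == None).
Proof.
rewrite X'E subv_cap; congr andb.
by apply/mem_suppP/eqP.
Qed.

Lemma region_cut t w : region X' t w = region X t w && (sigma w H == None).
Proof. by rewrite /region supp_le_cut andbAC. Qed.

(** From w go a little towards a vector of X on the required side of H, and then
in a direction generic in X. *)
Lemma cut_facet w s : supp w = X' ->
  exists y, [/\ facet w y, supp y = X & sigma y H = Some s].
Proof.
move=> wX'; have /subvPn[v0 v0X v0H] := XH.
have [v vX vH] : exists2 v, v \in val X & sgn (form H v) = Some s.
  move: v0H; rewrite mem_hyperplane; case sv: (sgn (form H v0)) => [b|]; last first.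
    by move/sgn0: sv => ->; rewrite eqxx.
  move=> _; have [<-|sb] := eqVneq b s; first by exists v0.
  exists (- v0); first by rewrite rpredN.
  by rewrite linearN sgnN sv /=; case: s b sb {sv} => [] [].
have [x xX] := flatP X.
have vx : supp (mmul (face_of A v) x) = X.
  by rewrite supp_mul ?xX // face_of_supp -xX.
have wX : (val (supp w) <= val X)%VS by rewrite wX' X'E capvSl.
pose y := mmul w (mmul (face_of A v) x).
have yX : supp y = X by rewrite supp_mul vx.
have wH : sigma w H = None.
  by apply/mem_suppP; rewrite wX' X'E capvSr.
have yH : sigma y H = Some s.
  by rewrite sigma_mul wH sigma_mul sigma_face_of vH.
exists y; split=> //; rewrite /facet yX cut_dim wX' eqxx andbT lt_neqAle.
apply/andP; split; first by apply/eqP => wy; move: yH; rewrite -wy wH.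
by apply/face_leP => K; rewrite sigma_mul; case: (sigma w K).
Qed.

Lemma cut_sum w s y0 : supp w = X' -> facet w y0 -> supp y0 = X -> sigma y0 H = Some s ->
  \sum_(y | facet w y && ((supp y == X) && (sigma y H == Some s))) inc w y = inc w y0.
Proof.
move=> wX' wy0 y0X y0H; rewrite (big_pred1 y0) // => y /=.
apply/idP/eqP => [/and3P[wy /eqP yX /eqP yH]|->]; last by rewrite wy0 y0X y0H !eqxx.
apply: (facet_side wy wy0 (H := H)); rewrite ?yX ?yH ?y0H //.
by apply/mem_suppP; rewrite wX' X'E capvSr.
Qed.
End Cut.

(** Induction on the number of hyperplanes that may cut the region. If there is
none, the region has at most one face, of support X, and c vanishes because its
augmentation does. Otherwise choose such a hyperplane H. If no face of the
region lies on H, all of them lie on the same side by elimination, and fixing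
this sign changes nothing but the measure. If H meets the region, the region is
the union of a section, on H, and of two halves on which the induction
hypothesis applies after c has been corrected on the section. *)
Theorem region_exact X t c :
    (forall w, ~~ region X t w -> c w = 0) ->
    (forall y, region X t y -> cell_boundary c y = 0) -> top_sum X c = 0 ->
  exists b, (forall w, ~~ region X t w -> b w = 0) /\
            (forall y, region X t y -> cell_boundary b y = c y).
Proof.
have [m] := ubnP #|free_hyperplanes X t|.
elim: m => // m IH in X t c *; rewrite ltnS => tm c_supp c_cycle c_top.
have [noH|] := eqVneq #|free_hyperplanes X t| 0%N.
  have full H : ~~ (val X <= val H)%VS -> t H <> None.
    by move=> XH tH; have := card0_eq noH H; rewrite !inE XH tH.
  have D1 y : region X t y -> supp y = X.
    case/regionP=> yX ty; apply/val_inj/eqP; rewrite eqEsubv yX /=.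
    apply/subv_bigcapP => H /eqP yH; apply: contraT => XH.
    by case: (full H XH); rewrite -ty //; apply: full.
  exists (fun=> 0); split=> // y yD; rewrite cell_boundary_eq0 //.
  rewrite -c_top /top_sum (bigD1 y) ?D1 //= big1 ?addr0 // => z /andP[/eqP zX zy].
  have [zD|/c_supp//] := boolP (region X t z).
  case/eqP: zy; apply: face_eqP => H.
  have [xH|xH] := boolP (val X <= val H)%VS.
    by rewrite (elimT (supp_le_flatP z X)) ?zX // (elimT (supp_le_flatP y X)) ?D1.
  have tH := full H xH.
  by have [/regionP[_ ->] // /regionP[_ ->]] := (zD, yD).
rewrite -lt0n => /card_gt0P[H /andP[XH /eqP tH]].
have mrefine s : (#|free_hyperplanes X (refine t H s)| < m)%N.
  exact: leq_trans (free_refine s XH tH) tm.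
have [[w0 /andP[w0D /eqP w0H]]|nocut] :=
  pselect (exists w, region X t w && (sigma w H == None)); last first.
  have [s sD] : exists s, forall w, region X t w -> sigma w H = Some s.
    apply: contrapT => /forallNP nos.
    have sign_of s : exists2 w, region X t w & sigma w H = Some s.
      apply/exists2P/notP => now; case: (nos (~~ s)) => w wD.
      case wH: (sigma w H) => [s'|]; last first.
        by case: nocut; exists w; rewrite wD wH.
      have [s'E|] := eqVneq s' s; last by case: s s' {now wH} => [] [].
      by case: now; exists w; rewrite // wH s'E.
    have [w1 /regionP[w1X w1t] w1H] := sign_of true.
    have [w2 /regionP[w2X w2t] w2H] := sign_of false.
    have [z zH zE] := face_elimination w1H w2H.
    case: nocut; exists z; rewrite zH andbT; apply/regionP; split.
      apply/supp_le_flatP => K XK.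
      by rewrite zE (supp_le_flatP _ _ w1X K XK) ?(supp_le_flatP _ _ w2X K XK).
    by move=> K tK; rewrite zE w1t // w2t.
  have sE w : region X (refine t H s) w = region X t w.
    rewrite region_refine //; apply/andb_idr => wD.
    by rewrite sD.
  have [||b [b_supp bE]] := IH X (refine t H s) c (mrefine s) _ _ c_top.
  - by move=> w; rewrite sE; apply: c_supp.
  - by move=> y; rewrite sE; apply: c_cycle.
  by exists b; split=> y; rewrite -(sE y); [apply: b_supp|apply: bE].
have [y' y'E] := flat_cap X H; pose X' := supp y'.
have X'E : val X' = (val X :&: val H)%VS by [].
have dX := cut_dim XH X'E.
have X'X : (val X' <= val X)%VS by rewrite X'E capvSl.
have w0X' : (val (supp w0) <= val X')%VS.
  by rewrite (supp_le_cut X'E) w0H eqxx andbT; case/regionP: w0D.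
pose w1 := mmul w0 y'.
have w1X' : supp w1 = X' by rewrite supp_mul.
have w1D : region X t w1.
  apply: (region_le w0D); last by rewrite w1X'.
  by apply/face_leP => K; rewrite sigma_mul; case: (sigma w0 K).
have w1H : sigma w1 H = None by apply/mem_suppP; rewrite w1X' X'E capvSr.
have [y1 [wy1 y1X y1H]] := cut_facet XH X'E true w1X'.
pose kappa : k := (inc w1 y1)%:~R.
have kappa2 : kappa * kappa = 1 by rewrite -intrM (incidence_sqr heps wy1).
have yHN y : supp y = X -> sigma y H <> None.
  by move=> yX /mem_suppP; rewrite yX (negPf XH).
pose plus s := fun y => (supp y == X) && (sigma y H == Some s).
have sum_plus w : supp w = X' ->
    (\sum_(y | facet w y && plus true y) inc w y)%:~R = kappa.
  move=> wX'; have [y [wy yX yH]] := cut_facet XH X'E true wX'.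
  rewrite (cut_sum X'E wX' wy yX yH).
  rewrite (incidence_side heps wy1 _ _ w1H); rewrite ?w1X' ?wX' ?y1X ?yX //.
    by rewrite yH y1H eqxx mul1r.
  by rewrite y1H.
have facet_top w y : facet w y -> supp y = X -> sigma w H = None -> supp w = X'.
  move=> wy yX wH; apply/val_inj/eqP; rewrite eqEdim (supp_le_cut X'E) wH.
  rewrite -yX supp_leW ?facet_le //= -ltnS -dX -yX (facet_dim wy).
  exact: leqnn.
(* The restriction c0 of c to the section has augmentation 0: sum the equations
   saying that the boundary of c vanishes over the top dimensional faces of one
   half. The walls inside the half cancel, and each top dimensional face w of
   the section is the wall of exactly one such face, with an incidence number
   kappa independent of w. *)
pose c0 w := if region X' t w then c w else 0.
have c0_top : top_sum X' c0 = 0.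
  have : \sum_(y | region X t y && plus true y) cell_boundary c y = 0.
    by apply: big1 => y /andP[yD _]; apply: c_cycle.
  rewrite sum_cell_boundary (bigID (fun w => region X' t w && (supp w == X'))) /=.
  rewrite [X in _ + X]big1 ?addr0; last first.
    move=> w wX'; have [wD|/c_supp ->] := boolP (region X t w); last by rewrite mul0rz.
    case wH: (sigma w H) => [[]|].
    - rewrite (eq_bigl (fun y => facet w y && (supp y == X))) ?sum_wall ?mulr0z // => y.
      apply: andb_id2l => wy; rewrite /plus.
      have -> : sigma y H == Some true by rewrite (elimT (face_leP _ _) (facet_le wy)) wH.
      rewrite andbT; apply/andb_idl => /eqP yX.
      by apply: (region_le wD); rewrite ?facet_le ?yX.
    - rewrite big_pred0 ?mulr0z // => y; apply/negP => /and4P[wy _ _].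
      by rewrite (elimT (face_leP _ _) (facet_le wy)) wH.
    - rewrite big_pred0 ?mulr0z // => y; apply/negP => /and4P[wy _ /eqP yX _].
      by case/negP: wX'; rewrite (region_cut X'E) wD wH (facet_top w y wy yX wH) !eqxx.
  rewrite (eq_bigr (fun w => kappa * c0 w)); last first.
    move=> w /andP[wD /eqP wX']; rewrite -(sum_plus w wX') /c0 wD mulrC mulrzr.
    congr (_ *~ _); apply: eq_bigl => y; apply: andb_id2l => wy.
    apply/andb_idl => /andP[/eqP yX _]; move: wD; rewrite (region_cut X'E) => /andP[wD _].
    by apply: (region_le wD); rewrite ?facet_le ?yX.
  rewrite -mulr_sumr => /(congr1 (fun e => kappa * e)); rewrite mulrA kappa2 mul1r mulr0.
  move=> E; apply: etrans E; rewrite /top_sum [LHS]big_mkcond [RHS]big_mkcond.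
  apply: eq_bigr => w _ /=.
  by rewrite /c0; case: (region X' t w); case: eqP.
have [||b0 [b0_supp b0E]] := IH X' t c0 (leq_trans (free_cut XH tH X'E) tm) _ _ c0_top.
- by move=> w /negPf wD; rewrite /c0 wD.
- move=> y yD; have := yD; rewrite (region_cut X'E) => /andP[/c_cycle yc /eqP yH].
  rewrite -yc; apply: eq_cell_boundary => w wy; rewrite /c0.
  case: ifP => // /negbT wD; apply/esym/c_supp; apply: contra wD => wD.
  rewrite (region_cut X'E) wD /=; apply/eqP.
  by apply: (elimT (supp_leP w y)) yH; rewrite supp_leW ?facet_le.
have c_cut w : region X' t w -> c0 w = c w by rewrite /c0 => ->.
(* A chain b0 of the section bounds c0 there. Subtracting its boundary
   from c leaves a chain of augmentation 0, whose sum S over one half need not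
   vanish. It is carried to the other half by the boundary of the top dimensional
   face w1 of the section, which contains no face of the section. *)
pose S := \sum_(y | plus true y) (c y - cell_boundary b0 y).
pose delta w : k := if w == w1 then kappa * S else 0.
pose b1 w := b0 w + delta w.
have b1_supp w : ~~ region X' t w -> b1 w = 0.
  move=> wD; rewrite /b1 b0_supp // /delta; case: eqP => [ww1|]; last by rewrite addr0.
  by case/negP: wD; rewrite ww1 (region_cut X'E) w1D w1H.
have b1E y : region X' t y -> cell_boundary b1 y = c y.
  move=> yD; rewrite cell_boundaryD b0E // c_cut // cell_boundary_eq0 ?addr0 //.
  move=> w wy; rewrite /delta.
  case: eqP => // ww1; have := dim_supp_lt (proj1 (andP wy)).
  by rewrite ww1 w1X' ltnNge dimvS //; case/regionP: yD.
pose c2 w := c w - cell_boundary b1 w.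
have c2_supp w : (val (supp w) <= val X)%VS -> ~~ region X t w -> c2 w = 0.
  move=> wX wD; rewrite /c2 c_supp // cell_boundary_eq0 ?subrr // => x xw.
  apply: b1_supp; apply: contra wD; rewrite (region_cut X'E) => /andP[xD _].
  exact: region_le xD (facet_le xw) wX.
have c2_cut w : region X' t w -> c2 w = 0 by move=> wD; rewrite /c2 b1E ?subrr.
have c2_cycle y : region X t y -> cell_boundary c2 y = 0.
  by move=> yD; rewrite /c2 cell_boundaryB (cell_boundary2 heps) c_cycle ?subrr.
have c2_top : top_sum X c2 = 0.
  rewrite /top_sum sumrB -/(top_sum X c) c_top.
  by rewrite -/(top_sum X (cell_boundary b1)) (top_sum_boundary heps) subrr.
have c2_plus : \sum_(y | plus true y) c2 y = 0.
  rewrite (eq_bigr (fun y => (c y - cell_boundary b0 y) - cell_boundary delta y)); last first.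
    by move=> y _; rewrite /c2 cell_boundaryD opprD addrA.
  rewrite sumrB sum_cell_boundary -/S (bigD1 w1) //=.
  rewrite [X in _ - (_ + X)]big1 ?addr0; last first.
    by move=> w ww1; rewrite /delta (negPf ww1) mul0rz.
  by rewrite /delta eqxx -mulrzr sum_plus // mulrAC kappa2 mul1r subrr.
have c2_minus : \sum_(y | plus false y) c2 y = 0.
  have := c2_top; rewrite /top_sum (bigID (fun y => sigma y H == Some true)) /=.
  rewrite -/(plus true) c2_plus add0r => E; apply: etrans E.
  apply: eq_bigl => y; rewrite /plus; apply: andb_id2l => /eqP/yHN.
  by case: (sigma y H) => [[]|].
(* Now c2 vanishes on the section and has augmentation 0 on each half. *)
have half s : exists b, (forall w, ~~ region X (refine t H s) w -> b w = 0) /\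
    (forall y, region X (refine t H s) y -> cell_boundary b y = c2 y).
  pose cs w := if region X (refine t H s) w then c2 w else 0.
  have [||| b [b_supp bE]] := IH X (refine t H s) cs (mrefine s).
  - by move=> w /negPf wD; rewrite /cs wD.
  - move=> y; rewrite region_refine // => /andP[yD /eqP yH].
    rewrite -(c2_cycle y yD); apply: eq_cell_boundary => w wy; rewrite /cs region_refine //.
    have wX : (val (supp w) <= val X)%VS.
      by apply: subv_trans (supp_leW (facet_le wy)) _; case/regionP: yD.
    have [wD|/(c2_supp _ wX)-> //] := boolP (region X t w).
    case wH: (sigma w H) => [s'|]; last by rewrite c2_cut // (region_cut X'E) wD wH.
    by rewrite -yH (elimT (face_leP _ _) (facet_le wy)) wH // eqxx.
  - have : \sum_(y | plus s y) c2 y = 0 by case: s {cs} => //.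
    move=> E; apply: etrans E; rewrite /top_sum [LHS]big_mkcond [RHS]big_mkcond.
    apply: eq_bigr => y _ /=.
    rewrite /plus /cs region_refine //; case: eqP => //= yX.
    case: eqP => //= _; rewrite ?andbF // andbT.
    by case: ifP => // /negbT yD; rewrite c2_supp // yX.
  exists b; split=> // y yD; rewrite bE // /cs yD //.
have [bt [bt_supp btE]] := half true.
have [bf [bf_supp bfE]] := half false.
have bs_zero s b y : (forall w, ~~ region X (refine t H s) w -> b w = 0) ->
    sigma y H <> Some s -> cell_boundary b y = 0.
  move=> b_supp yH; apply: cell_boundary_eq0 => w wy; apply: b_supp; rewrite region_refine //.
  apply/negP => /andP[_ /eqP wH]; case: yH.
  by rewrite (elimT (face_leP _ _) (facet_le wy)) wH.
exists (fun w => b1 w + (bt w + bf w)); split=> [w wD|y yD].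
  rewrite b1_supp ?bt_supp ?bf_supp ?addr0 // ?region_refine //.
  - by rewrite (negPf wD).
  - by rewrite (negPf wD).
  - by rewrite (region_cut X'E) (negPf wD).
have -> : cell_boundary (fun w => b1 w + (bt w + bf w)) y
    = cell_boundary b1 y + (cell_boundary bt y + cell_boundary bf y).
  by rewrite cell_boundaryD; congr (_ + _); apply: cell_boundaryD.
case yH: (sigma y H) => [[]|].
- rewrite (bs_zero false bf) ?yH // btE ?region_refine ?yD ?yH ?eqxx //.
  by rewrite addr0 addrC /c2 subrK.
- rewrite (bs_zero true bt) ?yH // bfE ?region_refine ?yD ?yH ?eqxx //.
  by rewrite add0r addrC /c2 subrK.
- rewrite (bs_zero true bt) ?yH // (bs_zero false bf) ?yH // !addr0.
  by rewrite b1E // (region_cut X'E) yD yH.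
Qed.
End Exactness.

(** * Projectivity of the modules of faces of given support *)

Section Projectivity.
Variables (k : fieldType) (R : realType) (d : nat) (A : arrangement R d).
Local Notation F := (face A).
Local Notation kF := {malg k[F]}.
Implicit Types (x y z w u : F) (X Y : flats A) (a b : kF) (c : k).

Lemma malg_faces a : a = \sum_(w : F) (a@_w)%:MP * << w >>.
Proof.
apply/malgP => x; rewrite raddf_sum /= (bigD1 x) //= big1 => [|w wx].
  by rewrite mcoeffCM mcoeffU1 eqxx mulr1 addr0.
by rewrite mcoeffCM mcoeffU1 (negPf wx) mulr0.
Qed.

Lemma faceM w u : << w >> * << u >> = << mmul w u >> :> kF.
Proof.
apply/malgP => x; rewrite mcoeffM_sum mcoeffU1 (bigD1 w) //= [X in _ + X]big1; last first.
  move=> v vw; apply: big1 => v' _.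
  by rewrite mcoeffU1 eq_sym (negPf vw) mul0r mul0rn.
rewrite (bigD1 u) //= [X in _ + X + _]big1 ?addr0; last first.
  by move=> v vu; rewrite !mcoeffU1 [u == v]eq_sym (negPf vu) mulr0 mul0rn.
by rewrite !mcoeffU1 !eqxx mul1r.
Qed.

Lemma malgC_comm c a : a * c%:MP = c%:MP * a.
Proof.
apply/malgP => x; rewrite [RHS]mcoeffCM [LHS]mcoeffM_sum.
transitivity (\sum_(w : F) a@_w * c *+ (w == x)).
  apply: eq_bigr => w _; rewrite (bigD1 (mone : F)) //= big1 => [|v v1].
    by rewrite addr0 mcoeffC eqxx mulr1n mulm1.
  by rewrite mcoeffC (negPf v1) mulr0n mulr0 mul0rn.
rewrite (bigD1 x) //= eqxx mulr1n big1 ?addr0 ?(mulrC c) // => w wx.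
by rewrite (negPf wx) mulr0n.
Qed.

Lemma malgC_mulCA c a b : a * (c%:MP * b) = c%:MP * (a * b).
Proof. by rewrite mulrA (malgC_comm c a) -mulrA. Qed.

(** Faces satisfy u v u = u v: multiplying twice by u adds no sign. *)
Lemma face_absorb u a : << u >> * a * << u >> = << u >> * a.
Proof.
rewrite [a]malg_faces mulr_sumr mulr_suml; apply: eq_bigr => w _.
rewrite (malgC_mulCA a@_w << u >> << w >>).
have E (p q r : kF) : p * (q * r) * q = p * (q * r * q) := esym (mulrA _ _ _).
apply: etrans (E _ _ _) _.
apply: (congr1 (fun g : kF => (a@_w)%:MP * g)).
rewrite (faceM u w).
rewrite (faceM (mmul u w) u).
suff -> : mmul (mmul u w) u = mmul u w by [].
apply: face_eqP => H; rewrite !sigma_mul.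
by case: (sigma u H) => //; case: (sigma w H).
Qed.

Lemma mul_absorb (S : pzRingType) (p q r : S) :
  p * q * p = p * q -> p * (q * ((1 - p) * r)) = 0.
Proof. by move=> pq; rewrite !mulrA mulrBr mulr1 pq subrr mul0r. Qed.

(** The product is over the faces that act by 0 on kF_Y, in an arbitrary order. *)
Definition projector Y : kF :=
  \prod_(v : F | ~~ (val (supp v) <= val Y)%VS) (1 - << v >>).

(** In the product u (1 - v_1) ... (1 - v_n) stop at the factor v_i = u. What comes
before has the form u a, and u a (1 - u) = u a - u a u = 0. *)
Lemma projector_kill Y u :
  ~~ (val (supp u) <= val Y)%VS -> << u >> * projector Y = 0.
Proof.
move=> uY; rewrite /projector.
have := mem_index_enum u.
case/splitPr => s1 s2; rewrite big_cat big_cons uY /=.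
exact/mul_absorb/face_absorb.
Qed.

Lemma scale_faceE Y w (v : face_mod k Y) (z : faces_of Y) :
  (<< w >> *: v) z = \sum_y v y * face_act k w y z.
Proof.
rewrite ffunE (bigD1 w) //= [X in _ + X]big1 ?addr0 => [|w' w'w].
  by apply: eq_bigr => y _; rewrite mcoeffU1 eqxx mul1r.
by apply: big1 => y _; rewrite mcoeffU1 eq_sym (negPf w'w) !mul0r.
Qed.

Lemma scale_malgCE Y c (v : face_mod k Y) (z : faces_of Y) : (c%:MP *: v) z = c * v z.
Proof.
rewrite ffunE (bigD1 (mone : F)) //= [X in _ + X]big1 ?addr0 => [|w w1]; last first.
  by apply: big1 => y _; rewrite mcoeffC (negPf w1) !mul0r.
rewrite (bigD1 z) //= big1 ?addr0 => [|y yz]; rewrite mcoeffC eqxx mulr1n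
  /face_act supp_one_le ffunE mul1m.
  by rewrite eqxx mulr1.
by rewrite (inj_eq val_inj) eq_sym (negPf yz) mulr0.
Qed.

Lemma face_mod_basis Y (v : face_mod k Y) :
  v = \sum_y ((v y : k)%:MP : kF) *: basis_vec k Y (val y).
Proof.
apply/ffunP => z; rewrite sum_ffunE (bigD1 z) //= big1 => [|y yz].
  by rewrite scale_malgCE ffunE eqxx mulr1 addr0.
by rewrite scale_malgCE ffunE (inj_eq val_inj) eq_sym (negPf yz) mulr0.
Qed.

Lemma scale_basis_vec Y w (y : faces_of Y) :
  << w >> *: basis_vec k Y (val y) = face_act k w y.
Proof.
apply/ffunP => z; rewrite scale_faceE (bigD1 y) //= big1 => [|x xy].
  by rewrite ffunE eqxx mul1r addr0.
by rewrite ffunE (inj_eq val_inj) (negPf xy) mul0r.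
Qed.

Lemma face_act_le Y w (y : faces_of Y) :
  (val (supp w) <= val Y)%VS -> face_act k w y = basis_vec k Y (mmul w (val y)).
Proof. by rewrite /face_act => ->. Qed.

Lemma face_act_nle Y w (y : faces_of Y) :
  ~~ (val (supp w) <= val Y)%VS -> face_act k w y = 0.
Proof. by rewrite /face_act => /negPf ->. Qed.

Lemma scale_face0 Y u (v : face_mod k Y) :
  ~~ (val (supp u) <= val Y)%VS -> << u >> *: v = 0.
Proof.
move=> uY; apply/ffunP => z; rewrite scale_faceE big1 ?ffunE // => y _.
by rewrite face_act_nle // ffunE mulr0.
Qed.

Lemma scale_fix (S : pzRingType) (M : lmodType S) (p q : S) (v : M) :
  q *: v = v -> p *: v = 0 -> ((1 - p) * q) *: v = v.
Proof. by move=> qv pv; rewrite -scalerA qv scalerBl scale1r pv subr0. Qed.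

Lemma projector_fix Y (v : face_mod k Y) : projector Y *: v = v.
Proof.
rewrite /projector; elim/big_rec: _ => [|u a uY IH]; first exact: scale1r.
by apply: scale_fix => //; apply: scale_face0.
Qed.

Lemma scale_sum_comm (S : pzRingType) (M : lmodType S) (I : finType) (p : S)
    (c : I -> S) (f : I -> M) :
  (forall i, p * c i = c i * p) ->
  p *: (\sum_i c i *: f i) = \sum_i c i *: (p *: f i).
Proof.
by move=> pc; rewrite scaler_sumr; apply: eq_bigr => i _; rewrite !scalerA pc.
Qed.

Lemma linear_pack (S : pzRingType) (M N : lmodType S) (f : M -> N) :
  linear f -> exists l : {linear M -> N}, l =1 f.
Proof.
move=> lin_f; pose fM := GRing.isLinear.Build S M N *:%R f lin_f.
by pose l : {linear M -> N} := HB.pack f fM; exists l.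
Qed.

Lemma scale_fix_l (S : pzRingType) (M : lmodType S) (p q : S) (v : M) :
  q *: v = v -> (p * q) *: v = p *: v.
Proof. by move=> qv; rewrite -scalerA qv. Qed.

Section Extend.
Variables (Y : flats A) (M : lmodType kF) (phi : F -> M).
Hypothesis phi_le : forall w y, (val (supp w) <= val Y)%VS -> supp y = Y ->
  << w >> *: phi y = phi (mmul w y).
Hypothesis phi_nle : forall w y, ~~ (val (supp w) <= val Y)%VS -> supp y = Y ->
  << w >> *: phi y = 0.

Definition extend (v : face_mod k Y) : M :=
  \sum_(y : faces_of Y) (v y)%:MP *: phi (val y).

Lemma extend_basis y : supp y = Y -> extend (basis_vec k Y y) = phi y.
Proof.
move=> yY; rewrite /extend (bigD1 (exist _ y (introT eqP yY) : faces_of Y)) //=.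
rewrite big1 ?addr0 => [|z zy].
  by rewrite ffunE eqxx mpolyC1E scale1r.
rewrite ffunE; case: eqP => [zE|_]; last by rewrite malgC0E scale0r.
by case/eqP: zy; apply: val_inj.
Qed.

Lemma extendD : {morph extend : v v' / v + v'}.
Proof.
move=> v v'; rewrite /extend -big_split; apply: eq_bigr => y _ /=.
by rewrite ffunE raddfD /= scalerDl.
Qed.

Lemma extendC c v : extend (c%:MP *: v) = c%:MP *: extend v.
Proof.
rewrite /extend [RHS]scaler_sumr; apply: eq_bigr => y _.
by rewrite scale_malgCE [in RHS]scalerA -mpolyCM.
Qed.

Lemma extend0 : extend 0 = 0.
Proof. by apply: big1 => y _; rewrite ffunE malgC0E scale0r. Qed.

Lemma extend_sum (I : finType) (f : I -> face_mod k Y) :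
  extend (\sum_i f i) = \sum_i extend (f i).
Proof. exact: (big_morph extend extendD extend0). Qed.

Lemma extend_face w v : extend (<< w >> *: v) = << w >> *: extend v.
Proof.
have comm (y : faces_of Y) : << w >> * (v y : k)%:MP = (v y : k)%:MP * << w >> :> kF.
  exact: malgC_comm.
have -> : << w >> *: v = \sum_(y : faces_of Y)
    ((v y : k)%:MP : kF) *: (<< w >> *: basis_vec k Y (val y)).
  by rewrite {1}(face_mod_basis v); apply: scale_sum_comm.
rewrite extend_sum; apply/esym/(etrans (scale_sum_comm _ comm))/eq_bigr => y _.
have yY := eqP (valP y); rewrite extendC scale_basis_vec.
apply: (congr1 (fun m => (v y)%:MP *: m)).
have [wY|wY] := boolP (val (supp w) <= val Y)%VS.
  by rewrite face_act_le // extend_basis ?phi_le // supp_mul yY.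
by rewrite face_act_nle // extend0 phi_nle.
Qed.

(** The hypotheses say that phi commutes with the action of faces; for the
extension to be linear over the whole algebra this is enough, because the
scalars are central. *)
Lemma extend_linear : linear extend.
Proof.
move=> a u v; rewrite extendD; congr (_ + _).
rewrite [a]malg_faces !scaler_suml extend_sum; apply: eq_bigr => w _.
by rewrite -!scalerA extendC extend_face.
Qed.
End Extend.

(** Let m be sent by g to the image under h of one basis face y0. The map
y |-> y e m, where e is the projector, is linear on kF_Y because w y e = 0 when
supp w is not below Y, and it lifts h because e fixes every
element of kF_Y and y y0 = y. *)
Lemma face_mod_projective Y : projective_module (face_mod k Y).
Proof.
move=> M N g h g_surj; have [y0 Y0] := flatP Y.
have [m gm] := g_surj (h (basis_vec k Y y0)).
pose phi y : M := (<< y >> * projector Y) *: m.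
have phi_le w y : (val (supp w) <= val Y)%VS -> supp y = Y ->
    << w >> *: phi y = phi (mmul w y).
  by move=> _ _; rewrite scalerA mulrA faceM.
have phi_nle w y : ~~ (val (supp w) <= val Y)%VS -> supp y = Y ->
    << w >> *: phi y = 0.
  move=> wY yY; rewrite scalerA mulrA faceM projector_kill ?scale0r //.
  by rewrite supp_mul_le negb_and wY.
have [l lE] := linear_pack (extend_linear phi_le phi_nle).
exists l => v; rewrite lE /extend raddf_sum [v in RHS]face_mod_basis raddf_sum.
apply: eq_bigr => y _.
apply: etrans (linearZZ g _ _) (etrans _ (esym (linearZZ h _ _))).
apply: (congr1 (fun n => (v y)%:MP *: n)).
rewrite /phi (linearZZ g) gm.
have yY := eqP (valP y).
have <- : << val y >> *: basis_vec k Y y0 = basis_vec k Y (val y).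
  rewrite (scale_basis_vec (val y) (exist _ y0 (introT eqP (esym Y0)) : faces_of Y)).
  rewrite face_act_le ?yY //=; congr (basis_vec k Y _).
  apply: face_eqP => H; rewrite sigma_mul; case yH: (sigma (val y) H) => //.
  have /supp_eqP yE : supp (val y) = supp y0 by rewrite yY.
  exact/yE.
rewrite (linearZZ h); apply: scale_fix_l.
by rewrite -(linearZZ h) projector_fix.
Qed.
End Projectivity.

(** * Direct sums of projective modules *)

Section DirectSumProjective.
Variables (S : pzRingType) (I : finType) (M : I -> lmodType S).

Lemma directsum_sumE (J : Type) (r : seq J) (P : pred J) (f : J -> directsum M) i :
  (\sum_(j <- r | P j) f j) i = \sum_(j <- r | P j) f j i.
Proof. by apply: (big_morph (fun u : directsum M => u i)) => [u v|]; rewrite ffunE. Qed.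

Definition directsum_in i (u : M i) : directsum M :=
  [ffun j => dfwith (fun j => 0 : M j) u j].

Lemma directsum_in_linear i : linear (@directsum_in i).
Proof.
move=> a u v; apply/ffunP => j; rewrite !ffunE.
have [<-|ij] := eqVneq i j; first by rewrite !dfwith_in.
by rewrite !dfwith_out // scaler0 addr0.
Qed.

Lemma directsum_inE (u : directsum M) : u = \sum_i directsum_in (u i).
Proof.
apply/ffunP => j; rewrite directsum_sumE (bigD1 j) //= ffunE dfwith_in.
by rewrite big1 ?addr0 // => i ij; rewrite ffunE dfwith_out.
Qed.

Lemma directsum_projective :
  (forall i, projective_module (M i)) -> projective_module (directsum M).
Proof.
move=> projM P N g h g_surj.
have lift i : exists l : {linear M i -> P}, forall u, g (l u) = h (directsum_in u).
  have hi_lin : linear (fun u : M i => h (directsum_in u)).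
    by move=> a u v; rewrite directsum_in_linear linearP.
  have [hi hiE] := linear_pack hi_lin.
  have [l lE] := projM i P N g hi g_surj.
  by exists l => u; rewrite lE hiE.
pose li i := sval (cid (lift i)).
have liE i u : g (li i u) = h (directsum_in u) := svalP (cid (lift i)) u.
have l_lin : linear (fun u : directsum M => \sum_i li i (u i)).
  move=> a u v; rewrite scaler_sumr -big_split; apply: eq_bigr => i _ /=.
  by rewrite !ffunE linearP.
have [l lE] := linear_pack l_lin.
exists l => u; rewrite lE raddf_sum [u in RHS]directsum_inE raddf_sum.
by apply: eq_bigr => i _; apply: liE.
Qed.
End DirectSumProjective.

(** * Linearity of the boundary and of the augmentation *)

Section Complex.
Variables (k : fieldType) (R : realType) (d : nat) (A : arrangement R d).
Local Notation V := 'rV[R]_d.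
Local Notation F := (face A).
Local Notation kF := {malg k[F]}.
Implicit Types (w x y z : F).
Variables (eps : flats A -> seq V -> int).
Hypothesis heps : forall Y, orientation (val Y) (eps Y).
Variable X : flats A.
Local Notation inc := (incidence eps).
Local Notation chain := (@chain k R d A X).
Local Notation chain_vec := (chain_vec k X).

Lemma chain_projective p : projective_module (chain p).
Proof. by apply: directsum_projective => Y; apply: face_mod_projective. Qed.

Lemma chi_faceE y : chi X (<< y >> : kF) = (val (supp y) <= val X)%VS%:R.
Proof. by rewrite /chi mmapU mul1r. Qed.

Lemma chi_malgC (c : k) : chi X (c%:MP : kF) = c.
Proof. by rewrite /chi mmapC. Qed.

Lemma scale_chi (a : kF) (c : chi_mod k X) : a *: c = (chi X a * c : k).
Proof. by []. Qed.

(** The module has dimension 1 over k, and k acts through multiples of 1. *)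
Lemma chi_mod_simple : simple_module (chi_mod k X).
Proof.
split; first by exists (1 : k); apply: oner_neq0.
move=> N [N0 Nlin]; have [[x xN x0]|no] := pselect (exists2 x, x \in N & x != 0).
  right => c; rewrite !inE.
  have := Nlin ((c / x : k)%:MP) x 0 xN N0; rewrite addr0.
  suff -> : ((c / x : k)%:MP : kF) *: x = c by [].
  by rewrite scale_chi chi_malgC divfK.
left => c; rewrite !inE; apply/idP/eqP => [cN|->//].
by apply/eqP; apply: contrapT => /negP c0; apply: no; exists c.
Qed.

Definition in_degree p x :=
  (val (supp x) <= val X)%VS && (\dim (val X) - \dim (val (supp x)) == p)%N.

Lemma in_degree_facet p w y : facet w y -> (val (supp y) <= val X)%VS ->
  in_degree p.+1 w = in_degree p y.
Proof.
move=> wy yX; rewrite /in_degree yX (subv_trans (supp_leW (facet_le wy)) yX) /=.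
have := dimvS yX; rewrite (facet_dim wy) => le.
by rewrite -[RHS]eqSS subnS prednK // subn_gt0.
Qed.

Lemma in_degree_flat p (Y : flats_codim X p) y : supp y = val Y -> in_degree p y.
Proof. by rewrite /in_degree => ->; apply: (valP Y). Qed.

Lemma basis_vec_eq0 (Y : flats A) y : supp y != Y -> basis_vec k Y y = 0.
Proof.
move=> yY; apply/ffunP => z; rewrite !ffunE; case: eqP => // zy.
by case/eqP: yY; rewrite -zy; apply/eqP/(valP z).
Qed.

Lemma chain_vec_eq0 p y : ~~ in_degree p y -> chain_vec p y = 0.
Proof.
move=> yp; apply/ffunP => Y; rewrite !ffunE basis_vec_eq0 //.
by apply: contra yp => /eqP; apply: in_degree_flat.
Qed.

Lemma facet_covers w y : facet w y -> covers y w.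
Proof.
move=> wy; rewrite /covers (proj1 (andP wy)); apply/existsP => -[z /andP[wz zy]].
by have := leq_ltn_trans (dim_supp_lt wz) (dim_supp_lt zy); rewrite (facet_dim wy) ltnn.
Qed.

Lemma scale_int (c : int) (M : lmodType kF) (m : M) :
  ((c%:~R : k)%:MP : kF) *: m = m *~ c.
Proof. by rewrite rmorph_int scaler_int. Qed.

(** The factor chi is absorbed: the faces y with support not below X lie in no
summand of degree p. So do the faces covering w of another dimension than
dim w + 1. *)
Lemma boundary_faceE p w : in_degree p.+1 w ->
  boundary_face k X eps p w = \sum_(y | facet w y) chain_vec p y *~ inc w y.
Proof.
move=> wp; rewrite /boundary_face [LHS]big_mkcond [RHS]big_mkcond.
apply: eq_bigr => y _.
have [yp|yp] := boolP (in_degree p y); last first.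
  by rewrite (chain_vec_eq0 yp) scaler0 mul0rz !if_same.
rewrite chi_faceE (proj1 (andP yp)) mulr1 scale_int.
suff -> : covers y w = facet w y by [].
apply/idP/idP; last exact: facet_covers.
case/andP=> wy _; rewrite /facet wy /=.
have /andP[wX /eqP dw] := wp; have /andP[yX /eqP dy] := yp.
have := subnK (dimvS wX); have := subnK (dimvS yX); rewrite dw dy => <-.
by rewrite addSnnS => /addnI ->.
Qed.

Lemma scale_chain_vec p w y : (val (supp w) <= val (supp y))%VS ->
  << w >> *: chain_vec p y = chain_vec p (mmul w y).
Proof.
move=> wy; apply/ffunP => Z; rewrite !ffunE.
have [yZ|yZ] := eqVneq (supp y) (val Z); last first.
  by rewrite !basis_vec_eq0 ?scaler0 ?supp_mul.
rewrite (scale_basis_vec k w (exist _ y (introT eqP yZ) : faces_of (val Z))).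
by rewrite face_act_le //= -yZ.
Qed.

Lemma scale_chain_vec0 p w y : ~~ (val (supp w) <= val (supp y))%VS ->
  << w >> *: chain_vec p y = 0.
Proof.
move=> wy; apply/ffunP => Z; rewrite !ffunE.
have [yZ|yZ] := eqVneq (supp y) (val Z); last by rewrite basis_vec_eq0 ?scaler0.
by rewrite scale_face0 // -yZ.
Qed.

Lemma scale_intC (S : pzRingType) (M : lmodType S) (a : S) (m : M) (c : int) :
  a *: (m *~ c) = (a *: m) *~ c.
Proof. by rewrite scalerMzr. Qed.

Lemma scale_boundary_face p w y : in_degree p.+1 y ->
  << w >> *: boundary_face k X eps p y
  = \sum_(z | facet y z) (<< w >> *: chain_vec p z) *~ inc y z.
Proof.
move=> yp; rewrite boundary_faceE // scaler_sumr.
by apply: eq_bigr => z _; apply: scale_intC.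
Qed.

(** Left multiplication by w is a bijection from the faces having y as a wall to
those having w y as a wall, with inverse the multiplication by y. It preserves
the sides of the wall because w vanishes on the hyperplanes through y. *)
Lemma boundary_face_le p w y :
  in_degree p.+1 y -> (val (supp w) <= val (supp y))%VS ->
  << w >> *: boundary_face k X eps p y = boundary_face k X eps p (mmul w y).
Proof.
move=> yp wy; have wyp : in_degree p.+1 (mmul w y) by rewrite /in_degree supp_mul.
rewrite (scale_boundary_face w yp) (boundary_faceE wyp).
rewrite [RHS](reindex_onto (mmul w) (mmul y)) /=; last first.
  move=> z /facet_le/face_leP wyz; apply: face_eqP => H.
  have := wyz H; rewrite !sigma_mul.
  by case: (sigma w H) => [b|]; [|case: (sigma y H) => [b|]] => // /(_ isT).
have wN H : sigma y H = None -> sigma w H = None by move: wy => /supp_leP; apply.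
have yw z : (y <= z)%O -> mmul y (mmul w z) = z.
  move=> /face_leP yz; apply: face_eqP => H; rewrite !sigma_mul.
  have := yz H; have := wN H; case: (sigma y H) => [b _ /(_ isT) //|/(_ erefl) -> //].
have facetE z : facet y z = facet (mmul w y) (mmul w z) && (mmul y (mmul w z) == z).
  apply/idP/andP => [yz|[wyz /eqP zE]].
    have le_yz := facet_le yz.
    have wz : (val (supp w) <= val (supp z))%VS := subv_trans wy (supp_leW le_yz).
    rewrite yw // eqxx; split=> //.
    rewrite /facet !supp_mul // (facet_dim yz) eqxx andbT lt_neqAle.
    apply/andP; split.
      apply: contra_eqN (facet_dim yz) => /eqP/(congr1 (@supp _ _ _)).
      by rewrite !supp_mul // => ->; rewrite neq_ltn ltnSn.
    apply/face_leP => H; rewrite !sigma_mul; case: (sigma w H) => //.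
    exact: (elimT (face_leP _ _) le_yz).
  have le_yz : (y <= z)%O.
    by rewrite -zE; apply/face_leP => H; rewrite sigma_mul; case: (sigma y H).
  have wz : (val (supp w) <= val (supp z))%VS := subv_trans wy (supp_leW le_yz).
  have := facet_dim wyz; rewrite !supp_mul // => dyz.
  rewrite /facet dyz eqxx andbT lt_neqAle le_yz andbT.
  by apply: contra_eqN dyz => /eqP ->; rewrite neq_ltn ltnSn.
rewrite [LHS](eq_bigl _ _ facetE); apply: eq_bigr => z; rewrite -facetE => yz.
have wz : (val (supp w) <= val (supp z))%VS := subv_trans wy (supp_leW (facet_le yz)).
rewrite (scale_chain_vec p wz); apply: (congr1 (fun c => chain_vec p (mmul w z) *~ c)).
have [H yH zH] := lt_separated (proj1 (andP yz)).
have wyE : supp y = supp (mmul w y) by rewrite supp_mul.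
have wzE : supp z = supp (mmul w z) by rewrite supp_mul.
rewrite (incidence_side heps yz wyE wzE yH zH).
by rewrite sigma_mul wN // eqxx mul1r.
Qed.

(** If supp z contains w and has y as a wall, it is spanned by supp y and supp w,
so no hyperplane through both y and w can separate the two sides of y in supp z.
Hence w identifies z with its reflection in y, and the terms cancel. *)
Lemma boundary_face_nle p w y :
  in_degree p.+1 y -> ~~ (val (supp w) <= val (supp y))%VS ->
  << w >> *: boundary_face k X eps p y = 0.
Proof.
move=> yp wy; rewrite (scale_boundary_face w yp).
rewrite (partition_big (@supp R d A) predT) //= big1 // => Z _.
apply: (wall_cancel heps) => z yz zZ.
have rz := reflect_supp (facet_le yz).
have [wz|wz] := boolP (val (supp w) <= val (supp z))%VS; last first.
  by rewrite !scale_chain_vec0 ?rz.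
rewrite !scale_chain_vec ?rz //; congr (chain_vec p _); apply: face_eqP => H.
rewrite !sigma_mul sigma_neg; case wH: (sigma w H) => //.
case yH: (sigma y H) => [b|].
  by rewrite (elimT (face_leP _ _) (facet_le yz)) yH.
suff -> : sigma z H = None by [].
case zH: (sigma z H) => [b|] //; case/negP: wy; apply/subvP => v wv.
apply: (mem_wall (supp_leW (facet_le yz)) (facet_dim yz) (f := form H) (v := point z)).
- by move=> u /mem_supp; apply.
- exact: point_supp.
- by rewrite form_point_neq0 zH.
- exact: (subvP wz).
- by move/mem_supp: wv; apply.
Qed.

Lemma boundaryE p c :
  boundary k X eps p c = \sum_Y extend (boundary_face k X eps p) (c Y).
Proof. by []. Qed.

Lemma boundary_linear p : linear (boundary k X eps p).
Proof.
move=> a u v; rewrite !boundaryE scaler_sumr -big_split; apply: eq_bigr => Y _ /=.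
rewrite !ffunE; apply: extend_linear => w y wY yY.
  by apply: (boundary_face_le (in_degree_flat yY)); rewrite yY.
by apply: (boundary_face_nle (in_degree_flat yY)); rewrite yY.
Qed.

Lemma augmentationE c :
  augmentation k X c = \sum_Y extend (fun _ => 1 : chi_mod k X) (c Y).
Proof.
apply: eq_bigr => Y _; apply: eq_bigr => y _.
by rewrite scale_chi chi_malgC mulr1.
Qed.

Lemma augmentation_linear : linear (augmentation k X : chain 0 -> chi_mod k X).
Proof.
move=> a u v; rewrite !augmentationE scaler_sumr -big_split; apply: eq_bigr => Y _ /=.
rewrite !ffunE; apply: extend_linear => w y; rewrite flats_codim0 => wX _;
  by rewrite scale_chi chi_faceE ?wX ?(negPf wX) ?mul1r ?mul0r.
Qed.
End Complex.

(** * Coefficients of chains *)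

Section Coefficients.
Variables (k : fieldType) (R : realType) (d : nat) (A : arrangement R d).
Local Notation F := (face A).
Implicit Types (w x y z : F).
Variable X : flats A.
Local Notation in_degree := (in_degree X).

Lemma supp_faces_of (Y : flats A) (y : faces_of Y) : supp (val y) = Y.
Proof. by case: y => y /= /eqP. Qed.

Lemma in_degree_elim p x (P : Prop) : in_degree p x ->
  (forall (Y : flats_codim X p) (y : faces_of (val Y)), val y = x -> P) -> P.
Proof.
move=> xp PY; pose Y : flats_codim X p := exist _ (supp x) xp.
exact: (PY Y (exist _ x (eqxx _) : faces_of (val Y))).
Qed.

Section Spread.
Variables (p : nat) (e : forall Y : flats_codim X p, faces_of (val Y) -> k).

(** A family indexed by the faces of the summands, extended by 0 to all faces. *)
Definition spread x : k :=
  \sum_(Y : flats_codim X p) \sum_(y : faces_of (val Y)) e y * (val y == x)%:R.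

Lemma spreadE (Y : flats_codim X p) (y : faces_of (val Y)) : spread (val y) = e y.
Proof.
rewrite /spread (bigD1 Y) //= [X in _ + X]big1 ?addr0 => [|Z ZY].
  rewrite (bigD1 y) //= eqxx mulr1 big1 ?addr0 // => z zy.
  by rewrite (inj_eq val_inj) (negPf zy) mulr0.
apply: big1 => z _; case: eqP => [zy|_]; last by rewrite mulr0.
case/eqP: ZY; apply: val_inj.
apply: etrans (esym (supp_faces_of z)) _.
exact: etrans (congr1 (@supp _ _ _) zy) (supp_faces_of y).
Qed.

Lemma spread_out x : ~~ in_degree p x -> spread x = 0.
Proof.
move=> xp; apply: big1 => Y _; apply: big1 => y _.
case: eqP => [yx|_]; last by rewrite mulr0.
by case/negP: xp; rewrite -yx; apply: (in_degree_flat (supp_faces_of y)).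
Qed.

Lemma sum_spread (G : F -> k) :
  \sum_x spread x * G x
  = \sum_(Y : flats_codim X p) \sum_(y : faces_of (val Y)) e y * G (val y).
Proof.
under eq_bigr => x _ do rewrite mulr_suml.
rewrite exchange_big /=; apply: eq_bigr => Y _.
under eq_bigr => x _ do rewrite mulr_suml.
rewrite exchange_big /=; apply: eq_bigr => y _.
rewrite (bigD1 (val y)) //= eqxx mulr1 big1 ?addr0 // => x xy.
by rewrite eq_sym (negPf xy) mulr0 mul0r.
Qed.
End Spread.

End Coefficients.

Section Entries.
Variables (k : fieldType) (R : realType) (d : nat) (A : arrangement R d).
Local Notation V := 'rV[R]_d.
Local Notation F := (face A).
Local Notation kF := {malg k[F]}.
Implicit Types (w x y z : F).
Variables (eps : flats A -> seq V -> int).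
Hypothesis heps : forall Y, orientation (val Y) (eps Y).
Variable X : flats A.
Local Notation inc := (incidence eps).
Local Notation chain := (@chain k R d A X).
Local Notation chain_vec := (chain_vec k X).
Local Notation cell_boundary := (@cell_boundary k R d A eps).
Local Notation in_degree := (in_degree X).

Definition entry p (c : chain p) (Y : flats_codim X p) (y : faces_of (val Y)) : k := c Y y.

Lemma entryD p (Y : flats_codim X p) (y : faces_of (val Y)) :
  {morph (fun c : chain p => entry c y) : a b / a + b}.
Proof. by move=> u v; rewrite /entry ffunE; apply: ffunE. Qed.

Lemma entry0 p (Y : flats_codim X p) (y : faces_of (val Y)) : entry (0 : chain p) y = 0.
Proof. by rewrite /entry ffunE; apply: ffunE. Qed.

Lemma entry_sum p (I : finType) (P : pred I) (f : I -> chain p)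
    (Y : flats_codim X p) (y : faces_of (val Y)) :
  entry (\sum_(i | P i) f i) y = \sum_(i | P i) entry (f i) y.
Proof. exact: (big_morph (fun u : chain p => entry u y) (entryD y) (entry0 y)). Qed.

Lemma entryZ p (a : k) (u : chain p) (Y : flats_codim X p) (y : faces_of (val Y)) :
  entry ((a%:MP : kF) *: u) y = a * entry u y.
Proof. by rewrite /entry ffunE; apply: scale_malgCE. Qed.

Lemma entry_vec p x (Y : flats_codim X p) (y : faces_of (val Y)) :
  entry (chain_vec p x) y = (val y == x)%:R.
Proof. by rewrite /entry ffunE; apply: ffunE. Qed.

Definition chain_of p (f : F -> k) : chain p := [ffun Y => [ffun y => f (val y)]].

Lemma entry_of p f (Y : flats_codim X p) (y : faces_of (val Y)) :
  entry (chain_of p f) y = f (val y).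
Proof. by rewrite /entry /chain_of ffunE; apply: ffunE. Qed.

Lemma entry_inj p (c c' : chain p) :
  (forall (Y : flats_codim X p) (y : faces_of (val Y)), entry c y = entry c' y) -> c = c'.
Proof. by move=> cc'; apply/ffunP => Y; apply/ffunP => y; apply: cc'. Qed.
Lemma additive_mulrz (U W : zmodType) (f : U -> W) u (c : int) :
  {morph f : a b / a + b} -> f (u *~ c) = f u *~ c.
Proof.
move=> fD; have f0 : f 0 = 0 by apply: (addrI (f 0)); rewrite -fD !addr0.
have fN a : f (- a) = - f a by apply: (addrI (f a)); rewrite -fD !subrr.
have fn n : f (u *+ n) = f u *+ n.
  by elim: n => [|n IH]; rewrite ?mulr0n // !mulrS fD IH.
by case: c => n; rewrite ?NegzE ?mulrNz ?fN -!pmulrn fn.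
Qed.

Lemma boundary_face_entry p w x (Y : flats_codim X p) (y : faces_of (val Y)) :
  in_degree p.+1 w -> val y = x ->
  entry (boundary_face k X eps p w) y = if facet w x then (inc w x)%:~R else 0.
Proof.
move=> wp yx; rewrite boundary_faceE // entry_sum.
transitivity (\sum_(z | facet w z) (x == z)%:R *~ inc w z : k).
  apply: eq_bigr => z _.
  by rewrite (additive_mulrz (chain_vec p z) (inc w z) (entryD y)) entry_vec yx.
rewrite big_mkcond (bigD1 x) //= eqxx big1 ?addr0 //.
by move=> z zy; rewrite eq_sym (negPf zy) mul0rz if_same.
Qed.

Definition coef p (c : chain p) : F -> k := spread (@entry p c).

Lemma coefE p (c : chain p) x (Y : flats_codim X p) (y : faces_of (val Y)) :
  val y = x -> coef c x = entry c y.
Proof. by move=> <-; apply: spreadE. Qed.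

Lemma coef_out p (c : chain p) x : ~~ in_degree p x -> coef c x = 0.
Proof. exact: spread_out. Qed.

Lemma coef_inj p (c c' : chain p) : coef c =1 coef c' -> c = c'.
Proof.
move=> cc'; apply: entry_inj => Y y.
exact: etrans (esym (coefE c (erefl _))) (etrans (cc' _) (coefE c' (erefl _))).
Qed.

Lemma coef0 p x : coef (0 : chain p) x = 0.
Proof.
have [xp|/coef_out //] := boolP (in_degree p x).
apply: (in_degree_elim xp) => Y y yx.
exact: etrans (coefE _ yx) (entry0 y).
Qed.

Lemma coef_of p f x : in_degree p x -> coef (chain_of p f) x = f x.
Proof.
move=> xp; apply: (in_degree_elim xp) => Y y yx.
by apply: etrans (coefE _ yx) (etrans (entry_of f y) _); rewrite yx.
Qed.

Lemma coef_boundary p (c : chain p.+1) x : in_degree p x ->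
  coef (boundary k X eps p c) x = cell_boundary (coef c) x.
Proof.
move=> xp; apply: (in_degree_elim xp) => Y y yx; apply: etrans (coefE _ yx) _.
pose G w : k := if facet w x then (inc w x)%:~R else 0.
transitivity (\sum_(Z : flats_codim X p.+1) \sum_(z : faces_of (val Z)) entry c z * G (val z)).
  apply: etrans (entry_sum _ _ y) _; apply: eq_bigr => Z _.
  apply: etrans (entry_sum _ _ y) _; apply: eq_bigr => z _.
  apply: etrans (entryZ _ _ y) _; apply: (congr1 (fun a => entry c z * a)).
  exact: (boundary_face_entry (in_degree_flat (supp_faces_of z)) yx).
rewrite -(sum_spread (@entry p.+1 c) G) -/(coef c) /cell_boundary [RHS]big_mkcond.
apply: eq_bigr => w _; rewrite /G; case: (facet w x); first by rewrite mulrzr.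
exact: mulr0.
Qed.

(** The flat X is the only one of codimension 0 in X. *)
Lemma augmentation_top (c : chain 0) : augmentation k X c = top_sum X (coef c) :> k.
Proof.
transitivity (\sum_x coef c x * 1).
  rewrite (sum_spread (@entry 0 c) (fun=> 1)); apply: eq_bigr => Y _.
  by apply: eq_bigr => y _; rewrite mulr1.
rewrite /top_sum [RHS]big_mkcond; apply: eq_bigr => x _; rewrite mulr1.
case: eqP => // xX; apply: coef_out; apply/negP => /andP[xle d0]; apply: xX.
by apply/val_inj/eqP; rewrite eqEdim xle -subn_eq0.
Qed.

Lemma in_degree0 x : supp x = X -> in_degree 0 x.
Proof. by rewrite /in_degree => ->; rewrite subvv subnn. Qed.

Lemma in_degreeS_top p x : supp x = X -> ~~ in_degree p.+1 x.
Proof. by rewrite /in_degree => ->; rewrite subnn andbF. Qed.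

(** Without sign conditions the region of X consists of all faces below X.
Exactness there yields a function on faces of mixed degrees, whose part of
degree p + 1 is the required chain since the boundary is homogeneous. *)
Lemma boundary_surj p (c : chain p) :
    (forall y, (val (supp y) <= val X)%VS -> cell_boundary (coef c) y = 0) ->
    top_sum X (coef c) = 0 ->
  exists b, boundary k X eps p b = c.
Proof.
move=> cyc ctop; pose t := fun _ : hyperplanes A => None : option bool.
have tE w : region X t w = (val (supp w) <= val X)%VS.
  by apply/regionP/idP => [[]|].
have [|y|b [b_supp bE]] := region_exact heps (X := X) (t := t) _ _ ctop.
- by move=> w; rewrite tE => wX; apply: coef_out; apply: contra wX => /andP[].
- by rewrite tE; apply: cyc.
exists (chain_of p.+1 b); apply: coef_inj => x.
have [xp|xp] := boolP (in_degree p x); last by rewrite !coef_out.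
have xX := proj1 (andP xp).
rewrite (coef_boundary _ xp) -bE ?tE //; apply: eq_cell_boundary => w wx.
by apply: coef_of; rewrite (in_degree_facet _ wx xX).
Qed.

(** In degree 0 every chain is a cycle for the boundary on functions, as a wall of
a face of codimension 0 has positive codimension. *)
Lemma exact0 : range (boundary k X eps 0) = [set c | augmentation k X c = 0].
Proof.
apply/seteqP; split => [_ [c _ <-]|c /= c0].
  rewrite /= augmentation_top; rewrite -[RHS](top_sum_boundary heps X (coef c)).
  by apply: eq_bigr => x /eqP xX; rewrite coef_boundary ?in_degree0.
have [|b bc] := @boundary_surj 0 c _ (etrans (esym (augmentation_top c)) c0).
  move=> y yX; apply: cell_boundary_eq0 => w wy; apply: coef_out.
  apply/negP => /andP[_]; have := dimvS yX; rewrite (facet_dim wy) => lt.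
  by rewrite subn_eq0 leqNgt lt.
by exists b.
Qed.

Lemma exactS p : range (boundary k X eps p.+1) = [set c | boundary k X eps p c = 0].
Proof.
apply/seteqP; split => [_ [c _ <-]|c /= c0].
  apply: coef_inj => x; have [xp|xp] := boolP (in_degree p x); last by rewrite !coef_out.
  rewrite (coef_boundary _ xp) coef0 -[RHS](cell_boundary2 heps (coef c) x).
  apply: eq_cell_boundary => w wx; apply: coef_boundary.
  by rewrite (in_degree_facet _ wx (proj1 (andP xp))).
have [||b bc] := @boundary_surj p.+1 c.
- move=> y yX; have [yp|yp] := boolP (in_degree p y).
    by rewrite -(coef_boundary c yp) c0 coef0.
  apply: cell_boundary_eq0 => w wy; apply: coef_out.
  by rewrite (in_degree_facet _ wy yX).
- by apply: big1 => x /eqP xX; apply/coef_out/in_degreeS_top.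
by exists b.
Qed.

Lemma augmentation_surj : range (augmentation k X) = [set: chi_mod k X].
Proof.
apply/seteqP; split => // a _; have [x xX] := flatP X.
pose f y : k := if y == x then a else 0.
exists (chain_of 0 f) => //; rewrite augmentation_top /top_sum.
rewrite (bigD1 x) ?xX //= coef_of ?in_degree0 // /f eqxx big1 ?addr0 // => y.
case/andP=> /eqP yX yx; rewrite coef_of ?in_degree0 ?yX //.
by rewrite (negPf yx).
Qed.
End Entries.

Theorem proposition7p4 (k : fieldType) (R : realType) (d : nat)
    (A : arrangement R d) (eps : flats A -> seq 'rV[R]_d -> int)
    (heps : forall Y : flats A, orientation (val Y) (eps Y)) (X : flats A) :
  simple_module (chi_mod k X) /\
  projective_resolution (boundary k X eps) (augmentation k X).
Proof.
split; first exact: chi_mod_simple.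
split.
- exact: chain_projective.
- by split=> [p|]; [apply: boundary_linear|apply: augmentation_linear].
- exact: augmentation_surj.
- exact: exact0.
- exact: exactS.
Qed.
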